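(* Let $\mathcal{D}$ be a monoidal dagger category with distributive dagger biproducts in which every dagger idempotent has a dagger splitting. Then the functor $$S\colon \mathrm{2Frob}_{\mathrm{sub}}(\mathcal{D})\to\mathrm{3Frob}_{\mathrm{n}}(\mathcal{D})$$ has a left adjoint $m\mapsto E(m)$, with the unit of the adjunction being the identity. Moreover, when addition of morphisms in $\mathcal{D}$ is idempotent (i.e. $f+f=f$ for all $f$), the 2-structure $E(m)$ is always special.
   Context: Monoidal categories are treated as strict. **Biproducts and splittings.** A dagger biproduct of $A,B$ is a biproduct $(A\oplus B,\kappa_A,\kappa_B,\pi_A,\pi_B)$ with $\pi_A=\kappa_A^\dagger$ and $\pi_B=\kappa_B^\dagger$. Dagger biproducts (finite, including a zero object) are distributive when the canonical map $v\colon(A\otimes B)\oplus(A\otimes C)\to A\otimes(B\oplus C)$ is an isomorphism with $v^{-1}=v^\dagger$. They make $\mathcal{D}$ enriched in commutative monoids, giving the addition $+$ and zero morphisms $0$. An isometry is a morphism $i$ with $i^\dagger i=\mathrm{id}$. A dagger idempotent $p$ (i.e. $p=p^\dagger p$) has a dagger splitting when $p=ii^\dagger$ for some isometry $i$. **Dagger duals.** $A$ and $A^*$ are dagger dual via $\eta_A\colon I\to A^*\otimes A$ and $\varepsilon_A\colon A\otimes A^*\to I$ when $(\varepsilon_A\otimes\mathrm{id}_A)(\mathrm{id}_A\otimes\eta_A)=\mathrm{id}_A$ and $(\mathrm{id}_{A^*}\otimes\varepsilon_A)(\eta_A\otimes\mathrm{id}_{A^*})=\mathrm{id}_{A^*}$,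 with $\eta_A'=\varepsilon_A^\dagger$ and $\varepsilon_A'=\eta_A^\dagger$. For $f\colon A\to B$ between objects with dagger duals, $f^*=(\mathrm{id}_{A^*}\otimes\varepsilon_B)(\mathrm{id}_{A^*}\otimes f\otimes\mathrm{id}_{B^*})(\eta_A\otimes\mathrm{id}_{B^*})\colon B^*\to A^*$ and $f_*=(f^* )^\dagger\colon A^*\to B^*$. **2-structures.** A dagger Frobenius 2-structure on $B$ is a monoid $(\mu,u)$ with $(\mu\otimes\mathrm{id})(\mathrm{id}\otimes\mu^\dagger)=(\mathrm{id}\otimes\mu)(\mu^\dagger\otimes\mathrm{id})$. It is special when $\mu\mu^\dagger=\mathrm{id}_B$. It is symmetric (on an object with a dagger dual $B^*$) when the morphisms $((u^\dagger\mu)\otimes\mathrm{id}_{B^*})(\mathrm{id}_B\otimes\eta_B')$ and $(\mathrm{id}_{B^*}\otimes(u^\dagger\mu))(\eta_B\otimes\mathrm{id}_B)$ from $B$ to $B^*$ coincide; the common value is the involution $j_B$. A morphism of symmetric dagger 2-structures $(B,\mu)\to(B',\mu')$ is $f\colon B\to B'$ with $f\mu=\mu'(f\otimes f)$ and $j_{B'}f=f_*j_B$. **3-structures.** A dagger Frobenius 3-structure consists of dagger dual objects $A,A^*$ and $m\colon A\otimes A^*\otimes A\to A$ with $m(\mathrm{id}_A\otimes\mathrm{id}_{A^*}\otimes m)=m(m\otimes\mathrm{id}_{A^*}\otimes\mathrm{id}_A)$ and $$(m\otimes\mathrm{id}_{A^*}\otimes\mathrm{id}_A)(\mathrm{id}_A\otimes\mathrm{id}_{A^*}\otimes\eta_A'\otimes\mathrm{id}_A)(\mathrm{id}_A\otimes\eta_A)=m^\dagger=(\mathrm{id}_A\otimes\mathrm{id}_{A^*}\otimes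 m)(\mathrm{id}_A\otimes\eta_A\otimes\mathrm{id}_{A^*}\otimes\mathrm{id}_A)(\eta_A'\otimes\mathrm{id}_A).$$ It is normal when $m(\eta_A'\otimes\mathrm{id}_A)=\mathrm{id}_A=m(\mathrm{id}_A\otimes\eta_A)$. A morphism $(A,m)\to(A',m')$ is $g\colon A\to A'$ with $gm=m'(g\otimes g_*\otimes g)$. $\mathrm{3Frob}_{\mathrm{n}}(\mathcal{D})$ is the category of normal dagger Frobenius 3-structures and these morphisms. Every symmetric dagger 2-structure $(B,\mu)$ yields a dagger 3-structure $m_\mu=\mu(\mu\otimes\mathrm{id}_B)(\mathrm{id}_B\otimes j_B^\dagger\otimes\mathrm{id}_B)$ on $B$. **Sub-3-structures.** A sub-3-structure of a symmetric dagger Frobenius 2-structure $(B,\mu)$ is a dagger 3-structure $(A,m)$ together with an isometry $i\colon A\to B$ that is a morphism of 3-structures $(A,m)\to(B,m_\mu)$. The objects of $\mathrm{2Frob}_{\mathrm{sub}}(\mathcal{D})$ are the sub-3-structures $(m,\ i\colon A\to B,\ \mu)$ with $m$ normal and $\mu\circ(i\otimes i)=0$. Its morphisms $(m,i,\mu)\to(m',i',\mu')$ are the morphisms of symmetric dagger 2-structures $f\colon(B,\mu)\to(B',\mu')$ with $f\circ i=i'\circ i'^\dagger\circ f\circ i$. The functor $S$ sends $(m,i,\mu)$ to $m$ and $f$ to $i'^\dagger\circ f\circ i$. That $E(m)$ is special means that the 2-structure component of the object $E(m)$ of $\mathrm{2Frob}_{\mathrm{sub}}(\mathcal{D})$ is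 special. *)

(* Defs.v *)
From Stdlib Require Import ssreflect ProofIrrelevance.

Set Implicit Arguments.
Unset Strict Implicit.
Unset Printing Implicit Defensive.

Declare Scope ob_scope.
Declare Scope mor_scope.
Delimit Scope ob_scope with ob.
Delimit Scope mor_scope with mor.
Local Open Scope ob_scope.
Local Open Scope mor_scope.

Reserved Notation "g \o f" (at level 50, left associativity).
Reserved Notation "f ^†" (at level 1, left associativity, format "f ^†").
Reserved Notation "A ⊗ B" (at level 40, left associativity).
Reserved Notation "A ⊕ B" (at level 50, left associativity).

Record category := Category {
  ob :> Type;
  hom : ob -> ob -> Type;
  idm : forall A, hom A A;
  comp : forall A B C, hom B C -> hom A B -> hom A C;
  comp1f : forall A B (f : hom A B), comp (idm B) f = f;
  compf1 : forall A B (f : hom A B), comp f (idm A) = f;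
  compA : forall A B C E (h : hom C E) (g : hom B C) (f : hom A B),
    comp h (comp g f) = comp (comp h g) f }.

Bind Scope ob_scope with ob.
Bind Scope mor_scope with hom.
Arguments hom {c} _%_ob _%_ob.
Arguments idm {c} _%_ob.
Arguments comp {c A B C} _%_mor _%_mor.
Notation "g \o f" := (comp g f) : mor_scope.

(* [f] is an identity morphism; in particular its domain and codomain are
   (strictly) equal. *)
Inductive is_identity (C : category) : forall A B : C, hom A B -> Prop :=
  IsIdentity : forall A : C, is_identity (idm A).

Record functor (C C' : category) := Functor {
  fob :> C -> C';
  fmap : forall A B : C, hom A B -> hom (fob A) (fob B);
  fmap1 : forall A : C, fmap (idm A) = idm (fob A);
  fmapM : forall (A B X : C) (g : hom B X) (f : hom A B),
    fmap (g \o f) = fmap g \o fmap f }.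
Arguments fmap {C C'} F {A B} f%_mor : rename.

(* [F] is the left adjoint. *)
Record adjunction (C C' : category) (F : functor C C') (G : functor C' C) :=
Adjunction {
  adj_unit : forall X : C, hom X (G (F X));
  adj_counit : forall Y : C', hom (F (G Y)) Y;
  adj_unit_natural : forall (X X' : C) (f : hom X X'),
    adj_unit X' \o f = fmap G (fmap F f) \o adj_unit X;
  adj_counit_natural : forall (Y Y' : C') (g : hom Y Y'),
    adj_counit Y' \o fmap F (fmap G g) = g \o adj_counit Y;
  adj_triangleF : forall X : C,
    adj_counit (F X) \o fmap F (adj_unit X) = idm (F X);
  adj_triangleG : forall Y : C',
    fmap G (adj_counit Y) \o adj_unit (G Y) = idm (G Y) }.

Record dagger_category := DaggerCategory {
  dcat :> category;
  dag : forall A B : dcat, hom A B -> hom B A;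
  dag1 : forall A : dcat, dag (idm A) = idm A;
  dagM : forall (A B C : dcat) (g : hom B C) (f : hom A B),
    dag (g \o f) = dag f \o dag g;
  dagK : forall (A B : dcat) (f : hom A B), dag (dag f) = f }.
Arguments dag {d A B} _%_mor.
Notation "f ^†" := (dag f) : mor_scope.

Definition isometry (D : dagger_category) (A B : D) (i : hom A B) : Prop :=
  i^† \o i = idm A.

Definition unitary (D : dagger_category) (A B : D) (f : hom A B) : Prop :=
  f^† \o f = idm A /\ f \o f^† = idm B.

Definition dagger_idempotent (D : dagger_category) (A : D) (p : hom A A) : Prop :=
  p = p^† \o p.

Definition has_dagger_splitting (D : dagger_category) (A : D) (p : hom A A) : Prop :=
  exists (B : D) (i : hom B A), isometry i /\ p = i \o i^†.

Definition dagger_idempotents_split (D : dagger_category) : Prop :=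
  forall (A : D) (p : hom A A), dagger_idempotent p -> has_dagger_splitting p.

(* Monoidal dagger categories are not assumed strict: they carry unitary
   coherence isomorphisms [α], [λ], [ρ], which the formulas below insert
   wherever a strict presentation leaves them out.  Their inverses are written
   as daggers. *)
Record monoidal_dagger_category := MonoidalDaggerCategory {
  mcat :> dagger_category;
  tens : mcat -> mcat -> mcat;
  tunit : mcat;
  tensm : forall A B A' B' : mcat,
    hom A B -> hom A' B' -> hom (tens A A') (tens B B');
  α : forall A B C : mcat, hom (tens (tens A B) C) (tens A (tens B C));
  λ : forall A : mcat, hom (tens tunit A) A;
  ρ : forall A : mcat, hom (tens A tunit) A;
  tensm1 : forall A B : mcat, tensm (idm A) (idm B) = idm (tens A B);
  tensmM : forall (A B C A' B' C' : mcat)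
      (g : hom B C) (f : hom A B) (g' : hom B' C') (f' : hom A' B'),
    tensm (g \o f) (g' \o f') = tensm g g' \o tensm f f';
  dag_tensm : forall (A B A' B' : mcat) (f : hom A B) (g : hom A' B'),
    (tensm f g)^† = tensm f^† g^†;
  α_natural : forall (A B C A' B' C' : mcat)
      (f : hom A A') (g : hom B B') (h : hom C C'),
    α A' B' C' \o tensm (tensm f g) h = tensm f (tensm g h) \o α A B C;
  λ_natural : forall (A B : mcat) (f : hom A B),
    λ B \o tensm (idm tunit) f = f \o λ A;
  ρ_natural : forall (A B : mcat) (f : hom A B),
    ρ B \o tensm f (idm tunit) = f \o ρ A;
  α_unitary : forall A B C : mcat, unitary (α A B C);
  λ_unitary : forall A : mcat, unitary (λ A);
  ρ_unitary : forall A : mcat, unitary (ρ A);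
  pentagon : forall A B C E : mcat,
    α A B (tens C E) \o α (tens A B) C E
    = tensm (idm A) (α B C E) \o α A (tens B C) E \o tensm (α A B C) (idm E);
  triangle : forall A B : mcat,
    tensm (idm A) (λ B) \o α A tunit B = tensm (ρ A) (idm B) }.

Arguments tunit {m}.
Arguments tens {m} _%_ob _%_ob.
Arguments tensm {m A B A' B'} _%_mor _%_mor.
Arguments α {m} A%_ob B%_ob C%_ob.
Arguments λ {m} A%_ob.
Arguments ρ {m} A%_ob.
Notation "'𝟙'" := tunit : ob_scope.
Notation "A ⊗ B" := (tens A B) : ob_scope.
Notation "f ⊗ g" := (tensm f g) : mor_scope.

(* The projections are not separate data: they are [(κ1 A B)^†], [(κ2 A B)^†].
   The zero object [zob] is the empty biproduct. *)
Record dagger_biproducts (D : dagger_category) := DaggerBiproducts {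
  zob : D;
  from0 : forall A : D, hom zob A;
  to0 : forall A : D, hom A zob;
  from0_uniq : forall (A : D) (f : hom zob A), f = from0 A;
  to0_uniq : forall (A : D) (f : hom A zob), f = to0 A;
  bip : D -> D -> D;
  κ1 : forall A B : D, hom A (bip A B);
  κ2 : forall A B : D, hom B (bip A B);
  bpair : forall X A B : D, hom X A -> hom X B -> hom X (bip A B);
  bcopair : forall A B X : D, hom A X -> hom B X -> hom (bip A B) X;
  bpair1 : forall (X A B : D) (f : hom X A) (g : hom X B),
    (κ1 A B)^† \o bpair f g = f;
  bpair2 : forall (X A B : D) (f : hom X A) (g : hom X B),
    (κ2 A B)^† \o bpair f g = g;
  bpair_uniq : forall (X A B : D) (h : hom X (bip A B)),
    h = bpair ((κ1 A B)^† \o h) ((κ2 A B)^† \o h);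
  bcopair1 : forall (A B X : D) (f : hom A X) (g : hom B X),
    bcopair f g \o κ1 A B = f;
  bcopair2 : forall (A B X : D) (f : hom A X) (g : hom B X),
    bcopair f g \o κ2 A B = g;
  bcopair_uniq : forall (A B X : D) (h : hom (bip A B) X),
    h = bcopair (h \o κ1 A B) (h \o κ2 A B);
  κ11 : forall A B : D, (κ1 A B)^† \o κ1 A B = idm A;
  κ22 : forall A B : D, (κ2 A B)^† \o κ2 A B = idm B;
  κ12 : forall A B : D, (κ2 A B)^† \o κ1 A B = from0 B \o to0 A;
  κ21 : forall A B : D, (κ1 A B)^† \o κ2 A B = from0 A \o to0 B }.

Arguments from0 {D} d A.
Arguments to0 {D} d A.
Arguments bip {D} d A B.
Arguments κ1 {D} d A B.
Arguments κ2 {D} d A B.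
Arguments bpair {D} d {X A B} f g.
Arguments bcopair {D} d {A B X} f g.

Section Biproducts.
Variables (D : dagger_category) (bp : dagger_biproducts D).

Definition zerom (A B : D) : hom A B := from0 bp B \o to0 bp A.

Definition addm (A B : D) (f g : hom A B) : hom A B :=
  bcopair bp f g \o bpair bp (idm A) (idm A).

End Biproducts.

Arguments zerom {D} bp A B.
Arguments addm {D} bp {A B} f g.

Section Distributivity.
Variables (D : monoidal_dagger_category) (bp : dagger_biproducts D).
Notation "A ⊕ B" := (bip bp A B) : ob_scope.

Definition distr_map (A B C : D) : hom ((A ⊗ B) ⊕ (A ⊗ C)) (A ⊗ (B ⊕ C)) :=
  bcopair bp (idm A ⊗ κ1 bp B C) (idm A ⊗ κ2 bp B C).

Definition distributive : Prop := forall A B C : D, unitary (distr_map A B C).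

End Distributivity.

(* An object together with a chosen dagger dual. *)
Record dual_pair (D : monoidal_dagger_category) := DualPair {
  dobj :> D;
  dual : D;
  η : hom 𝟙 (dual ⊗ dobj);
  ε : hom (dobj ⊗ dual) 𝟙;
  snake1 :
    λ dobj \o (ε ⊗ idm dobj) \o (α dobj dual dobj)^† \o (idm dobj ⊗ η)
      \o (ρ dobj)^† = idm dobj;
  snake2 :
    ρ dual \o (idm dual ⊗ ε) \o α dual dobj dual \o (η ⊗ idm dual)
      \o (λ dual)^† = idm dual }.

Arguments dual {D} d.
Arguments η {D} d.
Arguments ε {D} d.

Section Duals.
Variable D : monoidal_dagger_category.

Definition η' (A : dual_pair D) : hom 𝟙 (A ⊗ dual A) := (ε A)^†.
Definition ε' (A : dual_pair D) : hom (dual A ⊗ A) 𝟙 := (η A)^†.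

Definition upper_star (A B : dual_pair D) (f : hom A B) : hom (dual B) (dual A) :=
  ρ (dual A) \o (idm (dual A) ⊗ ε B) \o α (dual A) B (dual B)
    \o ((idm (dual A) ⊗ f) ⊗ idm (dual B)) \o (η A ⊗ idm (dual B))
    \o (λ (dual B))^†.

Definition lower_star (A B : dual_pair D) (f : hom A B) : hom (dual A) (dual B) :=
  (upper_star f)^†.

End Duals.

Record frob2 (D : monoidal_dagger_category) (B : D) := Frob2 {
  μ : hom (B ⊗ B) B;
  u : hom 𝟙 B;
  μA : μ \o (μ ⊗ idm B) = μ \o (idm B ⊗ μ) \o α B B B;
  μ1l : μ \o (u ⊗ idm B) = λ B;
  μ1r : μ \o (idm B ⊗ u) = ρ B;
  μ_frobenius :
    (μ ⊗ idm B) \o (α B B B)^† \o (idm B ⊗ μ^†)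
    = (idm B ⊗ μ) \o α B B B \o (μ^† ⊗ idm B) }.

Definition special (D : monoidal_dagger_category) (B : D) (M : frob2 B) : Prop :=
  μ M \o (μ M)^† = idm B.

Section Symmetric.
Variables (D : monoidal_dagger_category) (B : dual_pair D) (M : frob2 B).

Definition involution_l : hom B (dual B) :=
  λ (dual B) \o (((u M)^† \o μ M) ⊗ idm (dual B)) \o (α B B (dual B))^†
    \o (idm B ⊗ η' B) \o (ρ B)^†.

Definition involution_r : hom B (dual B) :=
  ρ (dual B) \o (idm (dual B) ⊗ ((u M)^† \o μ M)) \o α (dual B) B B
    \o (η B ⊗ idm B) \o (λ B)^†.

Definition symmetric : Prop := involution_l = involution_r.

End Symmetric.

(* A symmetric dagger Frobenius 2-structure includes the choice of dagger dual
   with respect to which it is symmetric. *)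
Record sym_frob2 (D : monoidal_dagger_category) := SymFrob2 {
  s2_obj :> dual_pair D;
  s2_frob : frob2 s2_obj;
  s2_symmetric : symmetric s2_frob }.

Section SymFrob2.
Variable D : monoidal_dagger_category.

Definition mult (B : sym_frob2 D) : hom (B ⊗ B) B := μ (s2_frob B).

Definition invol (B : sym_frob2 D) : hom B (dual B) := involution_l (s2_frob B).

Definition is_morphism2 (B B' : sym_frob2 D) (f : hom B B') : Prop :=
  f \o mult B = mult B' \o (f ⊗ f) /\ invol B' \o f = lower_star f \o invol B.

Definition ternary_of (B : sym_frob2 D) : hom (B ⊗ dual B ⊗ B) B :=
  mult B \o (mult B ⊗ idm B) \o (idm B ⊗ (invol B)^† ⊗ idm B).

End SymFrob2.

(* The isomorphisms between different bracketings and the insertions of the unit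
   object are the canonical ones; deleting every [α], [λ], [ρ] gives the strict
   form of the axioms. *)
Record frob3 (D : monoidal_dagger_category) (A : dual_pair D) := Frob3 {
  ter : hom (A ⊗ dual A ⊗ A) A;
  terA :
    ter \o (idm A ⊗ idm (dual A) ⊗ ter)
        \o (α (A ⊗ dual A) (A ⊗ dual A) A \o (α (A ⊗ dual A) A (dual A) ⊗ idm A))
    = ter \o (ter ⊗ idm (dual A) ⊗ idm A);
  ter_frobenius_l :
    (ter ⊗ idm (dual A) ⊗ idm A)
      \o ((α (A ⊗ dual A) A (dual A))^† ⊗ idm A)
      \o ((idm A ⊗ idm (dual A) ⊗ η' A) ⊗ idm A)
      \o ((ρ (A ⊗ dual A))^† ⊗ idm A)
      \o (α A (dual A) A)^† \o (idm A ⊗ η A) \o (ρ A)^†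
    = ter^†;
  ter_frobenius_r :
    ter^†
    = (idm A ⊗ idm (dual A) ⊗ ter)
      \o (α (A ⊗ dual A) (A ⊗ dual A) A \o (α (A ⊗ dual A) A (dual A) ⊗ idm A)
          \o ((α A (dual A) A)^† ⊗ idm (dual A) ⊗ idm A))
      \o ((idm A ⊗ η A) ⊗ idm (dual A) ⊗ idm A)
      \o ((ρ A)^† ⊗ idm (dual A) ⊗ idm A)
      \o (η' A ⊗ idm A) \o (λ A)^† }.

Definition normal (D : monoidal_dagger_category) (A : dual_pair D) (m : frob3 A) : Prop :=
  ter m \o (η' A ⊗ idm A) \o (λ A)^† = idm A
  /\ ter m \o (α A (dual A) A)^† \o (idm A ⊗ η A) \o (ρ A)^† = idm A.

Definition is_morphism3 (D : monoidal_dagger_category) (A A' : dual_pair D)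
    (m : hom (A ⊗ dual A ⊗ A) A) (m' : hom (A' ⊗ dual A' ⊗ A') A')
    (g : hom A A') : Prop :=
  g \o m = m' \o (g ⊗ lower_star g ⊗ g).

Record normal_frob3 (D : monoidal_dagger_category) := NormalFrob3 {
  n3_obj :> dual_pair D;
  n3_frob : frob3 n3_obj;
  n3_normal : normal n3_frob }.

Definition nter (D : monoidal_dagger_category) (A : normal_frob3 D) :
  hom (A ⊗ dual A ⊗ A) A := ter (n3_frob A).

Definition is_sub3 (D : monoidal_dagger_category) (A : dual_pair D) (m : frob3 A)
    (B : sym_frob2 D) (i : hom A B) : Prop :=
  isometry i /\ is_morphism3 (ter m) (ternary_of B) i.

Record sub_frob2 (D : monoidal_dagger_category) (bp : dagger_biproducts D) :=
SubFrob2 {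
  sub3 : normal_frob3 D;
  sub2 : sym_frob2 D;
  incl : hom sub3 sub2;
  incl_sub3 : is_sub3 (n3_frob sub3) incl;
  incl_sq0 : mult sub2 \o (incl ⊗ incl) = zerom bp (sub3 ⊗ sub3) sub2 }.

Definition is_morphism_sub (D : monoidal_dagger_category) (bp : dagger_biproducts D)
    (X Y : sub_frob2 bp) (f : hom (sub2 X) (sub2 Y)) : Prop :=
  is_morphism2 f /\ f \o incl X = incl Y \o (incl Y)^† \o f \o incl X.

Section Calculus.
Variable D : monoidal_dagger_category.

Lemma tens_compl (A B C E : D) (g : hom B C) (f : hom A B) :
  (g \o f) ⊗ idm E = (g ⊗ idm E) \o (f ⊗ idm E).
Proof. by rewrite -tensmM comp1f. Qed.

Lemma tens_compr (A B C E : D) (g : hom B C) (f : hom A B) :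
  idm E ⊗ (g \o f) = (idm E ⊗ g) \o (idm E ⊗ f).
Proof. by rewrite -tensmM comp1f. Qed.

Lemma tens_swap (A B A' B' : D) (f : hom A B) (g : hom A' B') :
  (idm B ⊗ g) \o (f ⊗ idm A') = (f ⊗ idm B') \o (idm A ⊗ g).
Proof. by rewrite -!tensmM !comp1f !compf1. Qed.

Lemma ααV (A B C : D) : α A B C \o (α A B C)^† = idm _.
Proof. exact: (proj2 (α_unitary A B C)). Qed.
Lemma αVα (A B C : D) : (α A B C)^† \o α A B C = idm _.
Proof. exact: (proj1 (α_unitary A B C)). Qed.
Lemma λλV (A : D) : λ A \o (λ A)^† = idm _.
Proof. exact: (proj2 (λ_unitary A)). Qed.
Lemma λVλ (A : D) : (λ A)^† \o λ A = idm _.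
Proof. exact: (proj1 (λ_unitary A)). Qed.
Lemma ρρV (A : D) : ρ A \o (ρ A)^† = idm _.
Proof. exact: (proj2 (ρ_unitary A)). Qed.
Lemma ρVρ (A : D) : (ρ A)^† \o ρ A = idm _.
Proof. exact: (proj1 (ρ_unitary A)). Qed.

Lemma λV_natural (A B : D) (f : hom A B) :
  (λ B)^† \o f = (idm 𝟙 ⊗ f) \o (λ A)^†.
Proof.
rewrite -[RHS]comp1f -(λVλ B) -compA (compA (λ B)) λ_natural.
by rewrite -compA λλV compf1.
Qed.

Lemma αV_natural (A B C A' B' C' : D) (f : hom A A') (g : hom B B') (h : hom C C') :
  (α A' B' C')^† \o (f ⊗ (g ⊗ h)) = (f ⊗ g ⊗ h) \o (α A B C)^†.
Proof.
rewrite -[RHS]comp1f -(αVα A' B' C') -compA.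
by rewrite (compA (α A' B' C')) α_natural -compA ααV compf1.
Qed.

Lemma epi_of_rinv (A B C : D) (e : hom A B) (s : hom B A) (f g : hom B C) :
  e \o s = idm B -> f \o e = g \o e -> f = g.
Proof. by move=> es E; rewrite -[f]compf1 -[g]compf1 -es !compA E. Qed.

Lemma mono_of_linv (A B C : D) (e : hom B C) (r : hom C B) (f g : hom A B) :
  r \o e = idm B -> e \o f = e \o g -> f = g.
Proof. by move=> re E; rewrite -[f]comp1f -[g]comp1f -re -!compA E. Qed.

Lemma unit_tens_inj (A B : D) (f g : hom A B) : idm 𝟙 ⊗ f = idm 𝟙 ⊗ g -> f = g.
Proof.
move=> E; apply: (epi_of_rinv (λλV A)).
by rewrite -!λ_natural E.
Qed.

Lemma tens_unit_inj (A B : D) (f g : hom A B) : f ⊗ idm 𝟙 = g ⊗ idm 𝟙 -> f = g.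
Proof.
move=> E; apply: (epi_of_rinv (ρρV A)).
by rewrite -!ρ_natural E.
Qed.

Lemma λ_tens (A B : D) : λ (A ⊗ B) \o α 𝟙 A B = λ A ⊗ idm B.
Proof.
apply: unit_tens_inj.
have sα : (α 𝟙 (𝟙 ⊗ A) B \o (α 𝟙 𝟙 A ⊗ idm B))
    \o (((α 𝟙 𝟙 A)^† ⊗ idm B) \o (α 𝟙 (𝟙 ⊗ A) B)^†) = idm _.
  by rewrite -compA (compA (α 𝟙 𝟙 A ⊗ _)) -tens_compl ααV tensm1 comp1f ααV.
apply: (epi_of_rinv sα).
rewrite tens_compr -!compA (compA (idm 𝟙 ⊗ α 𝟙 A B)) -pentagon.
rewrite compA triangle compA -α_natural -compA -tens_compl triangle.
by rewrite α_natural tensm1.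
Qed.

Lemma ρ_tens (A B : D) : (idm A ⊗ ρ B) \o α A B 𝟙 = ρ (A ⊗ B).
Proof.
apply: tens_unit_inj; rewrite tens_compl.
apply: (mono_of_linv (αVα A B 𝟙)).
rewrite compA α_natural -(triangle B 𝟙) tens_compr.
rewrite -!compA (compA (idm A ⊗ α _ _ _)) -pentagon -(triangle (A ⊗ B) 𝟙).
by rewrite !compA -(tensm1 A B) α_natural.
Qed.

Lemma λρ_unit : λ 𝟙 = ρ 𝟙 :> hom (𝟙 ⊗ 𝟙 : D) 𝟙.
Proof.
apply: tens_unit_inj.
rewrite -triangle -λ_tens; congr (_ \o _).
apply: (mono_of_linv (λVλ 𝟙)).
by rewrite λ_natural.
Qed.

Definition curry (A : dual_pair D) (X : D) (k : hom (A ⊗ X) 𝟙) : hom X (dual A) :=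
  ρ (dual A) \o (idm (dual A) ⊗ k) \o α (dual A) A X \o (η A ⊗ idm X) \o (λ X)^†.

Lemma curryK (A : dual_pair D) (X : D) (h : hom X (dual A)) :
  curry (ε A \o (idm A ⊗ h)) = h.
Proof.
rewrite /curry -[RHS]comp1f -[in RHS](snake2 A) -!compA λV_natural.
rewrite (compA (η A ⊗ _)) -tens_swap tens_compr -!compA.
by rewrite (compA (α _ _ _) (idm _ ⊗ h)) -tensm1 α_natural -!compA.
Qed.

Lemma ε_inj (A : dual_pair D) (X : D) (h h' : hom X (dual A)) :
  ε A \o (idm A ⊗ h) = ε A \o (idm A ⊗ h') -> h = h'.
Proof. by move=> E; rewrite -(curryK h) E curryK. Qed.

Lemma λ_ε_α_η (A : dual_pair D) (X : D) :
  λ (A ⊗ X) \o (ε A ⊗ idm (A ⊗ X)) \o (α A (dual A) (A ⊗ X))^†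
    \o (idm A ⊗ (α (dual A) A X \o (η A ⊗ idm X) \o (λ X)^†)) = idm (A ⊗ X).
Proof.
have penta : (α A (dual A) (A ⊗ X))^† \o (idm A ⊗ α (dual A) A X)
    = α (A ⊗ dual A) A X \o ((α A (dual A) A)^† ⊗ idm X) \o (α A (dual A ⊗ A) X)^†.
  apply: (mono_of_linv (αVα A (dual A) (A ⊗ X))).
  rewrite compA ααV comp1f !compA pentagon.
  rewrite -!compA (compA (α _ _ _ ⊗ idm X)) -tens_compl ααV tensm1 comp1f.
  by rewrite ααV compf1.
have triV : (α A 𝟙 X)^† \o (idm A ⊗ (λ X)^†) = (ρ A)^† ⊗ idm X.
  by rewrite -[idm A]dag1 -[idm X]dag1 -!dag_tensm -triangle dagM.
rewrite !tens_compr -!compA (compA (α A (dual A) (A ⊗ X))^†) penta -!compA.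
rewrite -(tensm1 A X) (compA (ε A ⊗ _)) -α_natural -!compA compA λ_tens.
rewrite (compA (α A (dual A ⊗ A) X)^†) αV_natural -!compA triV.
by rewrite -!tens_compl !compA snake1 tensm1.
Qed.

Lemma ε_curry (A : dual_pair D) (X : D) (k : hom (A ⊗ X) 𝟙) :
  ε A \o (idm A ⊗ curry k) = k.
Proof.
have ρE : idm A ⊗ ρ (dual A) = ρ (A ⊗ dual A) \o (α A (dual A) 𝟙)^†.
  by rewrite -ρ_tens -compA ααV compf1.
rewrite /curry -!compA !tens_compr ρE -!compA (compA (ε A)) -ρ_natural -λρ_unit.
rewrite (compA (α A (dual A) 𝟙)^†) αV_natural tensm1 -!compA.
rewrite (compA (ε A ⊗ _)) -tens_swap -!compA (compA (λ 𝟙)) λ_natural.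
rewrite -!tens_compr -!compA -[RHS]compf1; congr (_ \o _).
by rewrite -[RHS](λ_ε_α_η A X) !compA.
Qed.

Lemma upper_starE (A B : dual_pair D) (f : hom A B) :
  upper_star f = curry (ε B \o (f ⊗ idm (dual B))).
Proof.
by rewrite /upper_star /curry tens_compr -!compA (compA (α _ _ _) (_ ⊗ f ⊗ _)) α_natural -!compA.
Qed.

Lemma ε_upper_star (A B : dual_pair D) (f : hom A B) :
  ε A \o (idm A ⊗ upper_star f) = ε B \o (f ⊗ idm (dual B)).
Proof. by rewrite upper_starE ε_curry. Qed.

Lemma upper_star1 (A : dual_pair D) : upper_star (idm A) = idm (dual A).
Proof. by apply: ε_inj; rewrite ε_upper_star. Qed.

Lemma upper_starM (A B C : dual_pair D) (g : hom B C) (f : hom A B) :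
  upper_star (g \o f) = upper_star f \o upper_star g.
Proof.
apply: ε_inj; rewrite ε_upper_star tens_compr compA ε_upper_star.
by rewrite -compA -tens_swap compA ε_upper_star -compA -tens_compl.
Qed.

Lemma lower_star1 (A : dual_pair D) : lower_star (idm A) = idm (dual A).
Proof. by rewrite /lower_star upper_star1 dag1. Qed.

Lemma lower_starM (A B C : dual_pair D) (g : hom B C) (f : hom A B) :
  lower_star (g \o f) = lower_star g \o lower_star f.
Proof. by rewrite /lower_star upper_starM dagM. Qed.

Lemma frob2_snake1 (B : D) (M : frob2 B) :
  λ B \o (((u M)^† \o μ M) ⊗ idm B) \o (α B B B)^†
    \o (idm B ⊗ ((μ M)^† \o u M)) \o (ρ B)^† = idm B.
Proof.
rewrite tens_compl tens_compr -!compA.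
rewrite (compA (α _ _ _)^†) (compA (μ M ⊗ _)) (compA (μ M ⊗ _)) μ_frobenius.
rewrite -!compA (compA ((μ M)^† ⊗ _)) -tens_swap -(tensm1 B B) -!compA.
rewrite (compA (α _ _ _)) α_natural -!compA (compA (idm B ⊗ μ M)) -tens_compr μ1r.
rewrite (compA (idm B ⊗ ρ B)) ρ_tens (compA (ρ _)) ρ_natural -!compA ρρV compf1.
by rewrite -{1}(dag1 B) -dag_tensm -dagM μ1l λλV.
Qed.

Lemma frob2_snake2 (B : D) (M : frob2 B) :
  ρ B \o (idm B ⊗ ((u M)^† \o μ M)) \o α B B B
    \o (((μ M)^† \o u M) ⊗ idm B) \o (λ B)^† = idm B.
Proof.
have λE : (λ B ⊗ idm B) \o (α 𝟙 B B)^† = λ (B ⊗ B).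
  by rewrite -λ_tens -compA ααV compf1.
rewrite tens_compl tens_compr -!compA.
rewrite (compA (α _ _ _)) (compA (idm B ⊗ μ M)) (compA (idm B ⊗ μ M) (α _ _ _)).
rewrite -μ_frobenius -!compA (compA (idm B ⊗ (μ M)^†)) tens_swap -(tensm1 B B) -!compA.
rewrite (compA (α _ _ _)^†) αV_natural -!compA (compA (μ M ⊗ _)) -tens_compl μ1l.
rewrite (compA (λ B ⊗ _)) λE (compA (λ _)) λ_natural -!compA λλV compf1.
by rewrite -{1}(dag1 B) -dag_tensm -dagM μ1r ρρV.
Qed.

Definition self_dual (B : D) (M : frob2 B) : dual_pair D :=
  DualPair (frob2_snake1 M) (frob2_snake2 M).

Lemma invol_curry (B : sym_frob2 D) :
  invol B = curry ((u (s2_frob B))^† \o mult B).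
Proof. exact: s2_symmetric B. Qed.

Lemma invol_dag_curry (B : sym_frob2 D) :
  (invol B)^† = curry (A := self_dual (s2_frob B)) (ε B).
Proof.
rewrite /invol /involution_l /curry /η' !dagM !dag_tensm !dagM !dagK.
by rewrite !dag1 -!compA.
Qed.

Lemma invol_unitary (B : sym_frob2 D) : unitary (invol B).
Proof.
have eK : (u (s2_frob B))^† \o μ (s2_frob B) \o (idm B ⊗ (invol B)^†) = ε B.
  by rewrite invol_dag_curry; apply: (@ε_curry (self_dual (s2_frob B))).
have eJ : ε B \o (idm B ⊗ invol B) = (u (s2_frob B))^† \o μ (s2_frob B).
  by rewrite invol_curry ε_curry.
split.
  apply: (@ε_inj (self_dual (s2_frob B)) B) => /=.
  by rewrite tensm1 compf1 tens_compr compA eK eJ.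
apply: ε_inj.
by rewrite tensm1 compf1 tens_compr compA eJ eK.
Qed.

End Calculus.

Section Categories.
Variables (D : monoidal_dagger_category) (bp : dagger_biproducts D).

Lemma morphism3_id (A : normal_frob3 D) : is_morphism3 (nter A) (nter A) (idm A).
Proof. by rewrite /is_morphism3 comp1f lower_star1 !tensm1 compf1. Qed.

Lemma morphism3_comp (A B C : dual_pair D) (m : hom (A ⊗ dual A ⊗ A) A)
    (m' : hom (B ⊗ dual B ⊗ B) B) (m'' : hom (C ⊗ dual C ⊗ C) C)
    (g : hom B C) (f : hom A B) :
  is_morphism3 m' m'' g -> is_morphism3 m m' f -> is_morphism3 m m'' (g \o f).
Proof.
rewrite /is_morphism3 => gm fm.
by rewrite -compA fm compA gm lower_starM !tensmM compA.
Qed.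

Definition hom3 (A B : normal_frob3 D) : Type :=
  {g : hom A B | is_morphism3 (nter A) (nter B) g}.

Lemma sig_eq (T : Type) (P : T -> Prop) (x y : sig P) :
  proj1_sig x = proj1_sig y -> x = y.
Proof. by case: x y => [x Px] [y Py] /= E; apply: subset_eq_compat. Qed.

Definition frob3n_category : category.
Proof.
refine (@Category (normal_frob3 D) hom3
  (fun A => exist _ (idm A) (morphism3_id A))
  (fun A B C g f => exist _ (proj1_sig g \o proj1_sig f)
     (morphism3_comp (proj2_sig g) (proj2_sig f))) _ _ _).
- by move=> A B f; apply: sig_eq; apply: comp1f.
- by move=> A B f; apply: sig_eq; apply: compf1.
- by move=> A B C E h g f; apply: sig_eq; apply: compA.
Defined.

Definition hom_sub (X Y : sub_frob2 bp) : Type :=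
  {f : hom (sub2 X) (sub2 Y) | is_morphism_sub f}.

Lemma morphism_sub_id (X : sub_frob2 bp) : is_morphism_sub (X := X) (Y := X) (idm (sub2 X)).
Proof.
have [iso _] := incl_sub3 X.
split; first split.
- by rewrite tensm1 comp1f compf1.
- by rewrite lower_star1 comp1f compf1.
- by rewrite comp1f compf1 -compA iso compf1.
Qed.

Lemma morphism_sub_comp (X Y Z : sub_frob2 bp)
    (g : hom (sub2 Y) (sub2 Z)) (f : hom (sub2 X) (sub2 Y)) :
  is_morphism_sub g -> is_morphism_sub f -> is_morphism_sub (X := X) (Y := Z) (g \o f).
Proof.
move=> [[gμ gj] gi] [[fμ fj] fi]; split; first split.
- by rewrite -compA fμ compA gμ tensmM compA.
- by rewrite compA gj -compA fj lower_starM compA.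
- have E : g \o f \o incl X = g \o incl Y \o ((incl Y)^† \o f \o incl X).
    by rewrite -[LHS]compA fi !compA.
  have giE : incl Z \o (incl Z)^† \o (g \o incl Y) = g \o incl Y.
    by rewrite [RHS]gi !compA.
  by rewrite -[RHS]compA E [RHS]compA giE.
Qed.

Definition sub_category : category.
Proof.
refine (@Category (sub_frob2 bp) hom_sub
  (fun X => exist _ (idm (sub2 X)) (morphism_sub_id X))
  (fun X Y Z g f => exist _ (proj1_sig g \o proj1_sig f)
     (morphism_sub_comp (proj2_sig g) (proj2_sig f))) _ _ _).
- by move=> A B f; apply: sig_eq; apply: comp1f.
- by move=> A B f; apply: sig_eq; apply: compf1.
- by move=> A B C E h g f; apply: sig_eq; apply: compA.
Defined.

Lemma morphism2_ternary (B B' : sym_frob2 D) (f : hom B B') :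
  is_morphism2 f -> is_morphism3 (ternary_of B) (ternary_of B') f.
Proof.
move=> [fμ fj].
have fjV : f \o (invol B)^† = (invol B')^† \o lower_star f.
  have [_ jjV] := invol_unitary B; have [j'Vj' _] := invol_unitary B'.
  by rewrite -[LHS]comp1f -j'Vj' -(compA _ (invol B')) (compA (invol B') f) fj -compA jjV compf1.
have E : (f ⊗ f) \o ((mult B ⊗ idm B) \o (idm B ⊗ (invol B)^† ⊗ idm B))
    = (mult B' ⊗ idm B') \o (idm B' ⊗ (invol B')^† ⊗ idm B')
      \o (f ⊗ lower_star f ⊗ f).
  rewrite -!tensmM !comp1f !compf1 [in LHS](compA f) fμ.
  by rewrite -(compA (mult B')) -(compA (mult B')) -!tensmM compf1 comp1f fjV.
rewrite /is_morphism3 /ternary_of -(compA (mult B)) compA fμ.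
by rewrite -(compA (mult B')) E -!(compA (mult B')).
Qed.

Lemma restrict_morphism3 (X Y : sub_frob2 bp) (f : hom (sub2 X) (sub2 Y)) :
  is_morphism_sub f ->
  is_morphism3 (nter (sub3 X)) (nter (sub3 Y)) ((incl Y)^† \o f \o incl X).
Proof.
move=> [f2 fi].
have [_ iX] := incl_sub3 X; have [isoY iY] := incl_sub3 Y.
set g : hom (sub3 X) (sub3 Y) := _ \o incl X.
have ig : incl Y \o g = f \o incl X by rewrite fi !compA.
apply: (mono_of_linv isoY).
have := morphism3_comp (morphism2_ternary f2) iX.
rewrite -ig /is_morphism3 compA => ->.
by rewrite compA iY -compA lower_starM !tensmM.
Qed.

Lemma restrict_comp (X Y Z : sub_frob2 bp)
    (g : hom (sub2 Y) (sub2 Z)) (f : hom (sub2 X) (sub2 Y)) :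
  is_morphism_sub f ->
  (incl Z)^† \o (g \o f) \o incl X
  = (incl Z)^† \o g \o incl Y \o ((incl Y)^† \o f \o incl X).
Proof. by move=> [_ fi]; rewrite !compA -[LHS]compA fi !compA. Qed.

Definition restriction : functor sub_category frob3n_category.
Proof.
refine (@Functor sub_category frob3n_category (fun X : sub_frob2 bp => sub3 X)
  (fun (X Y : sub_frob2 bp) (f : hom_sub X Y) =>
     exist _ ((incl Y)^† \o proj1_sig f \o incl X)
       (restrict_morphism3 (proj2_sig f))) _ _).
- move=> X; apply: sig_eq => /=; rewrite compf1.
  exact: (proj1 (incl_sub3 X)).
- by move=> X Y Z g f; apply: sig_eq; apply: restrict_comp (proj2_sig f).
Defined.

End Categories.

(* Main.v *)
(* Since the monoidal structure is not strict, equations between morphisms are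
   checked on generalized elements [a : P -> A ⊗ Q] of [A].  These compose along
   the stages [P], [Q], associatively on the nose up to [α], and every element of
   [A ⊗ B] is such a composite, so that coherence isomorphisms disappear.

   For a normal 3-structure on [X0 = A] there is an opposite one on [X1 = A*].
   The map p sending x ⊗ y to the operator m(x, y, -), read in X0 ⊗ X1, is a
   dagger idempotent; it splits through L0, and likewise X1 ⊗ X0 contains L1.
   Then E(m) is the linking algebra of 2x2 matrices with entries in
   [[L0, X0], [X1, L1]].  With cups c in each block, mu^† = (mu ⊗ 1)(1 ⊗ c), from
   which the Frobenius law follows, and mu c = u + u, from which speciality
   follows when addition is idempotent.  For the dual given by its own Frobenius
   form E(m) has trivial involution.  A morphism from m to a substructure of B
   determines k0 : X0 -> B, hence k1 : X1 -> B through the involution, hence the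
   whole of E(m) -> B, because L0 and L1 consist of products; trace adjointness
   of k0 and k1 makes this map compatible with multiplication and involution. *)
From Stdlib Require Import ssreflect ClassicalEpsilon.
Require Import Defs.

Set Implicit Arguments.
Unset Strict Implicit.
Unset Printing Implicit Defensive.

Local Open Scope ob_scope.
Local Open Scope mor_scope.

(** * Generalized elements *)

Section Elements.
Variable D : monoidal_dagger_category.
Implicit Types A B C P Q R : D.

Definition el A P Q := hom P (A ⊗ Q).

Definition act A B P Q (f : hom A B) (a : el A P Q) : el B P Q :=
  (f ⊗ idm Q) \o a.

Definition tensel A B P Q R (a : el A P Q) (b : el B Q R) : el (A ⊗ B) P R :=
  (α A B R)^† \o (idm A ⊗ b) \o a.

Definition one P : el 𝟙 P P := (λ P)^†.

End Elements.

Arguments el {D} A%_ob P%_ob Q%_ob.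
Arguments act {D A B P Q} f%_mor a.
Arguments tensel {D A B P Q R} a b.
Arguments one {D} P%_ob.

Reserved Notation "f • a" (at level 46, right associativity).
Reserved Notation "a ⊡ b" (at level 42, left associativity).
Notation "f • a" := (act f a) : mor_scope.
Notation "a ⊡ b" := (tensel a b) : mor_scope.

Section ElementTheory.
Variable D : monoidal_dagger_category.
Implicit Types A B C P Q R S : D.

Lemma act_id A P Q (a : el A P Q) : idm A • a = a.
Proof. by rewrite /act tensm1 comp1f. Qed.

Lemma act_comp A B C P Q (g : hom B C) (f : hom A B) (a : el A P Q) :
  (g \o f) • a = g • f • a.
Proof. by rewrite /act tens_compl compA. Qed.

Lemma act_tens A B A' B' P Q R (f : hom A A') (g : hom B B')
    (a : el A P Q) (b : el B Q R) :
  (f ⊗ g) • a ⊡ b = (f • a) ⊡ (g • b).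
Proof.
rewrite /act /tensel !compA -αV_natural -!compA; congr (_ \o _).
by rewrite !compA -!tensmM !comp1f !compf1.
Qed.

(** This is the pentagon: naturality moves the elements aside, and what remains is the coherence
    equation [penta]. *)
Lemma act_α A B C P Q R S (a : el A P Q) (b : el B Q R) (c : el C R S) :
  α A B C • a ⊡ b ⊡ c = a ⊡ (b ⊡ c).
Proof.
have penta : (α A B C ⊗ idm S) \o (α (A ⊗ B) C S)^† \o (α A B (C ⊗ S))^†
    = (α A (B ⊗ C) S)^† \o (idm A ⊗ (α B C S)^†).
  apply: (mono_of_linv (αVα A (B ⊗ C) S)); rewrite [RHS]compA ααV comp1f.
  apply: (mono_of_linv (e := idm A ⊗ α B C S) (r := idm A ⊗ (α B C S)^†)).
    by rewrite -tens_compr αVα tensm1.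
  rewrite -[RHS]tens_compr ααV tensm1 !compA -pentagon.
  by rewrite -(compA (α A B _)) ααV compf1 ααV.
rewrite /act /tensel -(tensm1 A B) !tens_compr !compA -penta -!compA; do 2 congr (_ \o _).
by rewrite !compA -αV_natural.
Qed.

Lemma act_αV A B C P Q R S (a : el A P Q) (b : el B Q R) (c : el C R S) :
  (α A B C)^† • a ⊡ (b ⊡ c) = a ⊡ b ⊡ c.
Proof. by rewrite -act_α -act_comp αVα act_id. Qed.

Lemma act_λ A P Q (a : el A P Q) : λ A • one P ⊡ a = a.
Proof.
rewrite /act /tensel /one -λ_tens -!compA (compA (α _ _ _)) ααV comp1f.
by rewrite compA λ_natural -compA λλV compf1.
Qed.

Lemma act_ρ A P Q (a : el A P Q) : ρ A • a ⊡ one Q = a.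
Proof.
rewrite /act /tensel /one -triangle -!compA (compA (α _ _ _)) ααV comp1f.
by rewrite compA -tens_compr λλV tensm1 comp1f.
Qed.

Lemma act_λV A P Q (a : el A P Q) : (λ A)^† • a = one P ⊡ a.
Proof. by rewrite -{1}(act_λ a) -act_comp λVλ act_id. Qed.

Lemma act_ρV A P Q (a : el A P Q) : (ρ A)^† • a = a ⊡ one Q.
Proof. by rewrite -{1}(act_ρ a) -act_comp ρVρ act_id. Qed.

Lemma ρV_natural A B (f : hom A B) : (ρ B)^† \o f = (f ⊗ idm 𝟙) \o (ρ A)^†.
Proof.
rewrite -[RHS]comp1f -(ρVρ B) -compA (compA (ρ B)) ρ_natural.
by rewrite -compA ρρV compf1.
Qed.

(** The element [(ρ A)^†], at the stages [A] and [𝟙], is generic: acting on it gives back the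
    morphism up to [ρ]. *)
Lemma act_inj A B (f g : hom A B) :
  (forall P Q (a : el A P Q), f • a = g • a) -> f = g.
Proof.
move=> /(_ A 𝟙 (ρ A)^†); rewrite /act -!ρV_natural => E.
by apply: (mono_of_linv (ρρV B)).
Qed.

(** The intermediate stage may be any object, so it can absorb the whole second factor, which is
    then an identity. *)
Lemma tensel_surj A B P R (x : el (A ⊗ B) P R) :
  exists Q (a : el A P Q) (b : el B Q R), x = a ⊡ b.
Proof.
exists (B ⊗ R)%ob, (α A B R \o x), (idm (B ⊗ R)).
by rewrite /tensel tensm1 compf1 compA αVα comp1f.
Qed.

Lemma act_inj2 A B C (f g : hom (A ⊗ B) C) :
  (forall P Q R (a : el A P Q) (b : el B Q R), f • a ⊡ b = g • a ⊡ b) -> f = g.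
Proof.
by move=> E; apply: act_inj => P R x; have [Q [a [b ->]]] := tensel_surj x.
Qed.

Lemma act_inj3 A B C E (f g : hom (A ⊗ B ⊗ C) E) :
  (forall P Q R S (a : el A P Q) (b : el B Q R) (c : el C R S),
     f • a ⊡ b ⊡ c = g • a ⊡ b ⊡ c) -> f = g.
Proof.
move=> H; apply: act_inj2 => P R S x c.
by have [Q [a [b ->]]] := tensel_surj x.
Qed.

Lemma act_injl A B (f g : hom (𝟙 ⊗ A) B) :
  (forall P Q (a : el A P Q), f • one P ⊡ a = g • one P ⊡ a) -> f = g.
Proof.
move=> E; rewrite -[f]compf1 -[g]compf1 -(λVλ A) !compA; congr (_ \o _).
by apply: act_inj => P Q a; rewrite !act_comp act_λV.
Qed.

Lemma act_inj_one A (f g : hom 𝟙 A) :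
  (forall P, f • one P = g • one P) -> f = g.
Proof.
move=> /(_ 𝟙) E; apply: tens_unit_inj; rewrite -[f ⊗ _]compf1 -[g ⊗ _]compf1 -(λVλ 𝟙).
by rewrite !compA; congr (_ \o _).
Qed.

Lemma act_injr A B (f g : hom (A ⊗ 𝟙) B) :
  (forall P Q (a : el A P Q), f • a ⊡ one Q = g • a ⊡ one Q) -> f = g.
Proof.
move=> E; rewrite -[f]compf1 -[g]compf1 -(ρVρ A) !compA; congr (_ \o _).
by apply: act_inj => P Q a; rewrite !act_comp act_ρV.
Qed.

(** A scalar still has two stages, so it can act on either side. Snake identities become statements
    about a scalar acting on one half of a cup. *)
Definition scl A P Q R (x : el 𝟙 P Q) (a : el A Q R) : el A P R := λ A • x ⊡ a.
Definition scr A P Q R (a : el A P Q) (x : el 𝟙 Q R) : el A P R := ρ A • a ⊡ x.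

Lemma act_scl A B P Q R (f : hom A B) (x : el 𝟙 P Q) (a : el A Q R) :
  f • scl x a = scl x (f • a).
Proof. by rewrite /scl -act_comp -λ_natural act_comp act_tens act_id. Qed.

Lemma act_scr A B P Q R (f : hom A B) (a : el A P Q) (x : el 𝟙 Q R) :
  f • scr a x = scr (f • a) x.
Proof. by rewrite /scr -act_comp -ρ_natural act_comp act_tens act_id. Qed.

Lemma scl_tens A B P Q R S (x : el 𝟙 P Q) (a : el A Q R) (b : el B R S) :
  scl x a ⊡ b = scl x (a ⊡ b).
Proof. by rewrite /scl -(act_id b) -act_tens -λ_tens act_comp act_α act_id. Qed.

Lemma scr_tens A B P Q R S (a : el A P Q) (b : el B Q R) (x : el 𝟙 R S) :
  scr (a ⊡ b) x = a ⊡ scr b x.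
Proof. by rewrite /scr -[in RHS](act_id a) -act_tens -ρ_tens act_comp act_α. Qed.

Lemma tens_scl A B P Q R S (a : el A P Q) (x : el 𝟙 Q R) (b : el B R S) :
  a ⊡ scl x b = scr a x ⊡ b.
Proof.
by rewrite /scl /scr -{1}(act_id a) -{2}(act_id b) -!act_tens -triangle act_comp act_α.
Qed.

Lemma scr_scalar P Q R (x : el 𝟙 P Q) (y : el 𝟙 Q R) : scr x y = scl x y.
Proof. by rewrite /scr /scl λρ_unit. Qed.

(* The two halves of a cup [c], with the intermediate stage [B ⊗ P]. *)
Definition cupl A B (c : hom 𝟙 (A ⊗ B)) P : el A P (B ⊗ P) := α A B P \o (c • one P).
Definition cupr B P : el B (B ⊗ P) P := idm (B ⊗ P).

Lemma act_cup A B (c : hom 𝟙 (A ⊗ B)) P : c • one P = cupl c P ⊡ cupr B P.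
Proof. by rewrite /tensel tensm1 compf1 compA αVα comp1f. Qed.

End ElementTheory.

Arguments cupl {D A B} c%_mor P%_ob.
Arguments cupr {D} B%_ob P%_ob.

Definition elE := (act_comp, act_tens, act_α, act_αV, act_λV, act_ρV, act_cup, act_id).
(** * Biproducts and distributivity *)

Section Addition.
Variables (D : dagger_category) (bp : dagger_biproducts D).
Notation zero := (zerom bp).

Lemma comp0m (A B C : D) (f : hom A B) : zero B C \o f = zero A C.
Proof. by rewrite /zerom -compA (to0_uniq (to0 bp B \o f)). Qed.

Lemma compm0 (A B C : D) (f : hom B C) : f \o zero A B = zero A C.
Proof. by rewrite /zerom compA (from0_uniq (f \o from0 bp B)). Qed.

Lemma dag_zero (A B : D) : (zero A B)^† = zero B A.
Proof. by rewrite /zerom dagM (from0_uniq (to0 bp A)^†) (to0_uniq (from0 bp B)^†). Qed.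

Lemma bip_ext_dom (A B X : D) (h h' : hom (bip bp A B) X) :
  h \o κ1 bp A B = h' \o κ1 bp A B -> h \o κ2 bp A B = h' \o κ2 bp A B -> h = h'.
Proof. by move=> E1 E2; rewrite (bcopair_uniq h) E1 E2 -bcopair_uniq. Qed.

Lemma bip_ext_cod (A B X : D) (h h' : hom X (bip bp A B)) :
  (κ1 bp A B)^† \o h = (κ1 bp A B)^† \o h' ->
  (κ2 bp A B)^† \o h = (κ2 bp A B)^† \o h' -> h = h'.
Proof. by move=> E1 E2; rewrite (bpair_uniq h) E1 E2 -bpair_uniq. Qed.

Lemma comp_addm (A B C : D) (h : hom B C) (f g : hom A B) :
  h \o addm bp f g = addm bp (h \o f) (h \o g).
Proof.
rewrite /addm compA; congr (_ \o _).
by apply: bip_ext_dom; rewrite -!compA ?bcopair1 ?bcopair2.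
Qed.

Lemma addm_comp (A B C : D) (h : hom A B) (f g : hom B C) :
  addm bp f g \o h = addm bp (f \o h) (g \o h).
Proof.
(* [hh] is h ⊕ h, with respect to which the diagonal is natural. *)
pose hh := bcopair bp (κ1 bp B B \o h) (κ2 bp B B \o h).
have E : bcopair bp (f \o h) (g \o h) = bcopair bp f g \o hh.
  by apply: bip_ext_dom; rewrite -!compA ?bcopair1 ?bcopair2 compA ?bcopair1 ?bcopair2.
rewrite /addm E -!compA; congr (_ \o _).
have E1 : (κ1 bp B B)^† \o hh = h \o (κ1 bp A A)^†.
  apply: bip_ext_dom; rewrite -compA ?(bcopair1, bcopair2) compA -[RHS]compA.
    by rewrite !κ11 comp1f compf1.
  by rewrite !κ21 -!/(zerom bp _ _) comp0m compm0.
have E2 : (κ2 bp B B)^† \o hh = h \o (κ2 bp A A)^†.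
  apply: bip_ext_dom; rewrite -compA ?(bcopair1, bcopair2) compA -[RHS]compA.
    by rewrite !κ12 -!/(zerom bp _ _) comp0m compm0.
  by rewrite !κ22 comp1f compf1.
apply: bip_ext_cod; rewrite !compA.
  by rewrite E1 -(compA h) !bpair1 comp1f compf1.
by rewrite E2 -(compA h) !bpair2 comp1f compf1.
Qed.

Lemma addm0 (A B : D) (f : hom A B) : addm bp f (zero A B) = f.
Proof.
have E : bcopair bp f (zero A B) = f \o (κ1 bp A A)^†.
  apply: bip_ext_dom; rewrite -compA ?bcopair1 ?bcopair2 ?κ11 ?κ21 ?compf1 //.
  by rewrite -/(zerom bp _ _) compm0.
by rewrite /addm E -compA bpair1 compf1.
Qed.

Lemma add0m (A B : D) (f : hom A B) : addm bp (zero A B) f = f.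
Proof.
have E : bcopair bp (zero A B) f = f \o (κ2 bp A A)^†.
  apply: bip_ext_dom; rewrite -compA ?bcopair1 ?bcopair2 ?κ22 ?κ12 ?compf1 //.
  by rewrite -/(zerom bp _ _) compm0.
by rewrite /addm E -compA bpair2 compf1.
Qed.

Lemma bip_id (A B : D) :
  addm bp (κ1 bp A B \o (κ1 bp A B)^†) (κ2 bp A B \o (κ2 bp A B)^†) = idm _.
Proof.
apply: bip_ext_dom; rewrite addm_comp -!compA ?κ11 ?κ12 ?κ21 ?κ22 comp1f compf1.
  by rewrite -/(zerom bp _ _) compm0 addm0.
by rewrite -/(zerom bp _ _) compm0 add0m.
Qed.

Lemma bcopair_bpair (X A B Y : D) (f : hom X A) (g : hom X B) (f' : hom A Y)
    (g' : hom B Y) :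
  bcopair bp f' g' \o bpair bp f g = addm bp (f' \o f) (g' \o g).
Proof.
rewrite -(comp1f (bpair _ _ _)) -bip_id addm_comp comp_addm -!compA.
by rewrite bpair1 bpair2 !compA bcopair1 bcopair2.
Qed.

Lemma dag_addm (A B : D) (f g : hom A B) : (addm bp f g)^† = addm bp f^† g^†.
Proof.
have E (X Y Z : D) (f' : hom X Z) (g' : hom Y Z) :
    (bcopair bp f' g')^† = bpair bp f'^† g'^†.
  by apply: bip_ext_cod; rewrite -dagM ?bcopair1 ?bcopair2 ?bpair1 ?bpair2.
have E' : (bpair bp (idm A) (idm A))^† = bcopair bp (idm A) (idm A).
  by rewrite -{1 2}[idm A]dag1 -E dagK.
by rewrite /addm dagM E E' bcopair_bpair !comp1f.
Qed.

End Addition.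

(** * Tensoring and addition: distributivity on the left, and on the right via duals *)

Section TensorDistributivity.
Variables (D : monoidal_dagger_category) (bp : dagger_biproducts D).
Hypothesis distr : distributive bp.
Notation zero := (zerom bp).

(** A zero morphism is [κ1^†] after [κ2], and unitarity of the distributivity map keeps the tensored
    injections orthogonal. *)
Lemma tensm0r (A B C : D) : idm A ⊗ zero B C = zero (A ⊗ B) (A ⊗ C).
Proof.
have [E _] := distr A C B.
have -> : zero B C = (κ1 bp C B)^† \o κ2 bp C B by rewrite κ21.
rewrite tens_compr -{1}[idm A]dag1 -dag_tensm.
rewrite -(bcopair1 bp (idm A ⊗ κ1 bp C B) (idm A ⊗ κ2 bp C B)) -/(distr_map bp A C B).
rewrite -(bcopair2 bp (idm A ⊗ κ1 bp C B) (idm A ⊗ κ2 bp C B)) -/(distr_map bp A C B).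
by rewrite dagM -!compA (compA (distr_map bp A C B)^†) E comp1f κ21.
Qed.

Lemma bip_ext_tensr (A B C X : D) (h h' : hom (A ⊗ bip bp B C) X) :
  h \o (idm A ⊗ κ1 bp B C) = h' \o (idm A ⊗ κ1 bp B C) ->
  h \o (idm A ⊗ κ2 bp B C) = h' \o (idm A ⊗ κ2 bp B C) -> h = h'.
Proof.
move=> E1 E2; have [_ E] := distr A B C.
apply: (epi_of_rinv E).
by apply: bip_ext_dom; rewrite -!compA ?bcopair1 ?bcopair2.
Qed.

Lemma tensm_addr (A B C : D) (f g : hom B C) :
  idm A ⊗ addm bp f g = addm bp (idm A ⊗ f) (idm A ⊗ g).
Proof.
have E : idm (A ⊗ bip bp B B)
    = addm bp (idm A ⊗ (κ1 bp B B \o (κ1 bp B B)^†)) (idm A ⊗ (κ2 bp B B \o (κ2 bp B B)^†)).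
  apply: bip_ext_tensr; rewrite addm_comp -!tens_compr -!compA.
    by rewrite κ11 κ12 -/(zerom bp _ _) compm0 compf1 tensm0r addm0 comp1f.
  by rewrite κ22 κ21 -/(zerom bp _ _) compm0 compf1 tensm0r add0m comp1f.
rewrite {1}/addm tens_compr -(compf1 (idm A ⊗ _)) E comp_addm addm_comp.
by rewrite -!tens_compr !compA bcopair1 bcopair2 -!compA bpair1 bpair2 !compf1.
Qed.

(* Distributivity is assumed on the left only; on the right it is a property of
   the second factor, shared by all objects with a dual. *)
Definition rdistr (Y : D) : Prop :=
  (forall (A B : D) (f g : hom A B),
     addm bp f g ⊗ idm Y = addm bp (f ⊗ idm Y) (g ⊗ idm Y))
  /\ (forall A B : D, zero A B ⊗ idm Y = zero (A ⊗ Y) (B ⊗ Y)).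

(** Transposition along the cup turns maps out of [A ⊗ Y] faithfully into maps out of [A]. Hence
    tensoring with [Y] on the right keeps the biproduct injections jointly epic and maps out of the
    zero object unique, which gives both laws. *)
Lemma rdistr_cup (Y Y' : D) (c : hom 𝟙 (Y ⊗ Y')) (e : hom (Y' ⊗ Y) 𝟙) :
  ρ Y \o (idm Y ⊗ e) \o α Y Y' Y \o (c ⊗ idm Y) \o (λ Y)^† = idm Y -> rdistr Y.
Proof.
move=> zag.
pose tr A B (h : hom (A ⊗ Y) B) : hom A (B ⊗ Y') :=
  (h ⊗ idm Y') \o (α A Y Y')^† \o (idm A ⊗ c) \o (ρ A)^†.
have trE A B C (f : hom A B) (h : hom (B ⊗ Y) C) :
    tr _ _ (h \o (f ⊗ idm Y)) = tr _ _ h \o f.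
  by apply: act_inj => P Q a; rewrite /tr !elE.
have tr_inj A B (h h' : hom (A ⊗ Y) B) : tr _ _ h = tr _ _ h' -> h = h'.
  have trK (k : hom (A ⊗ Y) B) :
      k = ρ B \o (idm B ⊗ e) \o α B Y' Y \o (tr _ _ k ⊗ idm Y).
    apply: act_inj2 => P Q R a y; rewrite /tr !elE.
    have {1}<- : scr (cupl c Q) (e • cupr Y' Q ⊡ y) = y.
      by rewrite -[RHS]act_id -zag !elE.
    by rewrite -scr_tens act_scr.
  by move=> E; rewrite (trK h) (trK h') E.
have ext A B X (h h' : hom (bip bp A B ⊗ Y) X) :
    h \o (κ1 bp A B ⊗ idm Y) = h' \o (κ1 bp A B ⊗ idm Y) ->
    h \o (κ2 bp A B ⊗ idm Y) = h' \o (κ2 bp A B ⊗ idm Y) -> h = h'.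
  by move=> E1 E2; apply: tr_inj; apply: bip_ext_dom; rewrite -!trE ?E1 ?E2.
have tens0 A B : zero A B ⊗ idm Y = zero (A ⊗ Y) (B ⊗ Y).
  rewrite /zerom tens_compl.
  have -> : from0 bp B ⊗ idm Y = zero (zob bp ⊗ Y) (B ⊗ Y).
    by apply: tr_inj; apply: eq_trans (from0_uniq _) (eq_sym (from0_uniq _)).
  by rewrite comp0m.
split=> // A B f g.
have E : idm (bip bp A A ⊗ Y)
    = addm bp ((κ1 bp A A \o (κ1 bp A A)^†) ⊗ idm Y) ((κ2 bp A A \o (κ2 bp A A)^†) ⊗ idm Y).
  apply: ext; rewrite addm_comp -!tens_compl -!compA.
    by rewrite κ11 κ12 -/(zerom bp _ _) compm0 compf1 tens0 addm0 comp1f.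
  by rewrite κ22 κ21 -/(zerom bp _ _) compm0 compf1 tens0 add0m comp1f.
rewrite {1}/addm tens_compl -(compf1 (_ ⊗ idm Y)) E comp_addm addm_comp.
by rewrite -!tens_compl !compA bcopair1 bcopair2 -!compA bpair1 bpair2 !compf1.
Qed.

Lemma rdistr_dobj (Y : dual_pair D) : rdistr Y.
Proof.
apply: (@rdistr_cup Y (dual Y) (ε Y)^† (η Y)^†).
by have := f_equal dag (snake1 Y); rewrite !dagM !dag_tensm !dagK !dag1 !compA.
Qed.

Lemma rdistr_dual (Y : dual_pair D) : rdistr (dual Y).
Proof. exact: (@rdistr_cup (dual Y) Y (η Y) (ε Y) (snake2 Y)). Qed.

Lemma rdistr_tens (Y Z : D) : rdistr Y -> rdistr Z -> rdistr (Y ⊗ Z).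
Proof.
move=> [Yadd Y0] [Zadd Z0].
have E A B (f : hom A B) :
    f ⊗ idm (Y ⊗ Z) = α B Y Z \o (f ⊗ idm Y ⊗ idm Z) \o (α A Y Z)^†.
  by rewrite α_natural -compA ααV compf1 tensm1.
split=> [A B f g|A B]; rewrite !E.
  by rewrite Yadd Zadd comp_addm addm_comp.
by rewrite Y0 Z0 compm0 comp0m.
Qed.

Lemma rdistr_retract (Y Z : D) (s : hom Z Y) (r : hom Y Z) :
  r \o s = idm Z -> rdistr Y -> rdistr Z.
Proof.
move=> rs [Yadd Y0].
have E A B (f : hom A B) : f ⊗ idm Z = (idm B ⊗ r) \o (f ⊗ idm Y) \o (idm A ⊗ s).
  by rewrite -!tensmM !comp1f !compf1 rs.
split=> [A B f g|A B]; rewrite !E.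
  by rewrite Yadd comp_addm addm_comp.
by rewrite Y0 compm0 comp0m.
Qed.

Lemma rdistr_bip (Y Z : D) : rdistr Y -> rdistr Z -> rdistr (bip bp Y Z).
Proof.
move=> [Yadd Y0] [Zadd Z0].
split=> [A B f g|A B]; apply: bip_ext_tensr.
- by rewrite addm_comp -!tens_swap Yadd comp_addm.
- by rewrite addm_comp -!tens_swap Zadd comp_addm.
- by rewrite comp0m -tens_swap Y0 compm0.
- by rewrite comp0m -tens_swap Z0 compm0.
Qed.

End TensorDistributivity.
(** * Matrix algebras *)

Section FrobeniusCriterion.
Variables (D : monoidal_dagger_category) (B : D).
Variables (μ0 : hom (B ⊗ B) B) (u0 : hom 𝟙 B) (c0 : hom 𝟙 (B ⊗ B)).
Hypothesis assoc : μ0 \o (μ0 ⊗ idm B) = μ0 \o (idm B ⊗ μ0) \o α B B B.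
Hypothesis unitl : μ0 \o (u0 ⊗ idm B) = λ B.
Hypothesis unitr : μ0 \o (idm B ⊗ u0) = ρ B.
Hypothesis adjoint : μ0^† = (μ0 ⊗ idm B) \o (α B B B)^† \o (idm B ⊗ c0) \o (ρ B)^†.

(** Associativity identifies the left side with [μ0^† \o μ0], which is self-adjoint; the right side
    is the dagger of the left. *)
Lemma frobenius_criterion :
  (μ0 ⊗ idm B) \o (α B B B)^† \o (idm B ⊗ μ0^†)
  = (idm B ⊗ μ0) \o α B B B \o (μ0^† ⊗ idm B).
Proof.
have E : (μ0 ⊗ idm B) \o (α B B B)^† \o (idm B ⊗ μ0^†) = μ0^† \o μ0.
  apply: act_inj2 => P Q R a b; rewrite adjoint !elE; congr (_ ⊡ _).
  have := f_equal (fun f => f • a ⊡ b ⊡ cupl c0 R) assoc.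
  by rewrite !elE.
by rewrite E -[μ0 in LHS](dagK μ0) -dagM dagK -E !dagM !dag_tensm !dagK dag1 compA.
Qed.

Definition frob2_of_adjoint : frob2 B := Frob2 assoc unitl unitr frobenius_criterion.

(** By associativity [μ0 \o μ0^†] is right multiplication by [μ0 \o c0]. *)
Lemma special_of_adjoint : μ0 \o c0 = u0 -> special frob2_of_adjoint.
Proof.
move=> E; apply: act_inj => P Q a; rewrite /special /= adjoint !elE.
have := f_equal (fun f => f • a ⊡ cupl c0 Q ⊡ cupr B Q) assoc.
rewrite !elE => ->; rewrite -act_cup -act_comp E.
have := f_equal (fun f => f • a ⊡ one Q) unitr.
by rewrite !elE act_ρ.
Qed.

End FrobeniusCriterion.

(* A dagger Frobenius category with two objects: the blocks are its hom-objects,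
   and its matrix algebra (the sum of all blocks) is a dagger Frobenius monoid. *)
Record frobenius_blocks (D : monoidal_dagger_category) := FrobeniusBlocks {
  blk : bool -> bool -> D;
  bmul : forall i j k, hom (blk i j ⊗ blk j k) (blk i k);
  bunit : forall i, hom 𝟙 (blk i i);
  bcup : forall i j, hom 𝟙 (blk i j ⊗ blk j i);
  bmulA : forall i j k l,
    bmul i k l \o (bmul i j k ⊗ idm _)
    = bmul i j l \o (idm _ ⊗ bmul j k l) \o α _ _ _;
  bmul1l : forall i j, bmul i i j \o (bunit i ⊗ idm _) = λ _;
  bmul1r : forall i j, bmul i j j \o (idm _ ⊗ bunit j) = ρ _;
  bmul_dag : forall i j k,
    (bmul i j k)^†
    = (bmul i k j ⊗ idm _) \o (α _ _ _)^† \o (idm _ ⊗ bcup k j) \o (ρ _)^†;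
  bmul_cup : forall i j, bmul i j i \o bcup i j = bunit i }.

(** Orthogonality of blocks is stated with [negb], so comparisons of indices are split in this
    form. *)
Lemma eq_or_negb (i j : bool) : j = i \/ j = negb i.
Proof. by case: i; case: j; [left|right|right|left]. Qed.

Section MatrixAlgebra.
Variables (D : monoidal_dagger_category) (bp : dagger_biproducts D).
Hypothesis distr : distributive bp.
Notation zero := (zerom bp).

Lemma tens0m (A B Y Z : D) (f : hom Y Z) :
  rdistr bp Z -> zero A B ⊗ f = zero (A ⊗ Y) (B ⊗ Z).
Proof.
move=> [_ Z0]; rewrite -[f]comp1f -[zero A B]compf1 tensmM Z0.
by rewrite comp0m.
Qed.

Lemma tensm0 (A B Y Z : D) (f : hom A B) :
  f ⊗ zero Y Z = zero (A ⊗ Y) (B ⊗ Z).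
Proof. by rewrite -[f]comp1f -[zero Y Z]compf1 tensmM tensm0r // comp0m. Qed.

Definition sum2 (A B : D) (F : bool -> hom A B) : hom A B :=
  addm bp (F false) (F true).

Lemma sum2_pick (A B : D) (i : bool) (F : bool -> hom A B) :
  F (negb i) = zero A B -> sum2 F = F i.
Proof. by rewrite /sum2; case: i => /= ->; rewrite ?addm0 ?add0m. Qed.

Lemma eq_sum2 (A B : D) (F G : bool -> hom A B) :
  (forall i, F i = G i) -> sum2 F = sum2 G.
Proof. by move=> E; rewrite /sum2 !E. Qed.

Lemma sum2_comp (A B C : D) (F : bool -> hom B C) (h : hom A B) :
  sum2 F \o h = sum2 (fun i => F i \o h).
Proof. exact: addm_comp. Qed.

Lemma comp_sum2 (A B C : D) (F : bool -> hom A B) (h : hom B C) :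
  h \o sum2 F = sum2 (fun i => h \o F i).
Proof. exact: comp_addm. Qed.

Lemma dag_sum2 (A B : D) (F : bool -> hom A B) :
  (sum2 F)^† = sum2 (fun i => (F i)^†).
Proof. exact: dag_addm. Qed.

Lemma tens_sum2 (A B C E : D) (f : hom A E) (F : bool -> hom B C) :
  f ⊗ sum2 F = sum2 (fun i => f ⊗ F i).
Proof.
rewrite -[f]compf1 -[sum2 F]comp1f tensmM /sum2 tensm_addr // comp_addm.
by rewrite -!tensmM !comp1f !compf1.
Qed.

Lemma sum2_tens (A B Y Z : D) (F : bool -> hom A B) (f : hom Y Z) :
  rdistr bp Y -> sum2 F ⊗ f = sum2 (fun i => F i ⊗ f).
Proof.
case=> Yadd _; rewrite -[f]compf1 -[sum2 F]comp1f tensmM /sum2 Yadd comp_addm.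
by rewrite -!tensmM !comp1f !compf1.
Qed.

Variable blk : bool -> bool -> D.
Hypothesis blk_rdistr : forall i j, rdistr bp (blk i j).

Definition mx : D := bip bp (bip bp (blk false false) (blk false true))
                           (bip bp (blk true false) (blk true true)).

Definition inj i j : hom (blk i j) mx :=
  match i, j with
  | false, false => κ1 bp _ _ \o κ1 bp _ _
  | false, true => κ1 bp _ _ \o κ2 bp _ _
  | true, false => κ2 bp _ _ \o κ1 bp _ _
  | true, true => κ2 bp _ _ \o κ2 bp _ _
  end.

Lemma mx_rdistr : rdistr bp mx.
Proof. by do ![apply: rdistr_bip => //]. Qed.

Let inj_simp (A B C E F : D) (f : hom A B) (g : hom E A) (h : hom C B) (k : hom F C) :
  (f \o g)^† \o (h \o k) = g^† \o (f^† \o h \o k).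
Proof. by rewrite dagM -!compA. Qed.

Lemma inj_id i j : (inj i j)^† \o inj i j = idm _.
Proof. by case: i; case: j; rewrite /inj inj_simp ?(κ11, κ22) comp1f ?(κ11, κ22). Qed.

Lemma inj_row i j l : (inj (negb i) l)^† \o inj i j = zero _ _.
Proof.
by case: i; case: j; case: l; rewrite /= inj_simp ?(κ12, κ21) -/(zerom bp _ _)
  comp0m compm0.
Qed.

Lemma inj_col i k l : (inj i (negb l))^† \o inj k l = zero _ _.
Proof.
have [->|->] := eq_or_negb k i; last exact: inj_row.
by case: k; case: l; rewrite /= inj_simp ?(κ11, κ22) comp1f ?(κ12, κ21).
Qed.

Lemma inj_row' i j l : (inj i l)^† \o inj (negb i) j = zero _ _.
Proof. by rewrite -[LHS]dagK dagM dagK inj_row dag_zero. Qed.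

Lemma inj_col' i k l : (inj i l)^† \o inj k (negb l) = zero _ _.
Proof. by rewrite -[LHS]dagK dagM dagK inj_col dag_zero. Qed.

Lemma mx_id : sum2 (fun i => sum2 (fun j => inj i j \o (inj i j)^†)) = idm mx.
Proof.
have E (A B C X : D) (f : hom B A) (g : hom C A) (h : hom A X) :
    addm bp ((h \o f) \o (h \o f)^†) ((h \o g) \o (h \o g)^†)
    = h \o addm bp (f \o f^†) (g \o g^†) \o h^†.
  by rewrite comp_addm addm_comp !dagM !compA.
by rewrite /sum2 /inj !E !bip_id !compf1 bip_id.
Qed.

Lemma mx_ext (X : D) (f g : hom mx X) :
  (forall i j, f \o inj i j = g \o inj i j) -> f = g.
Proof.
move=> E; rewrite -[f]compf1 -[g]compf1 -mx_id !comp_sum2.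
by apply: eq_sum2 => i; rewrite !comp_sum2; apply: eq_sum2 => j; rewrite !compA E.
Qed.

Lemma mx_ext_tensr (Y X : D) (f g : hom (Y ⊗ mx) X) :
  (forall i j, f \o (idm Y ⊗ inj i j) = g \o (idm Y ⊗ inj i j)) -> f = g.
Proof.
move=> E; rewrite -[f]compf1 -[g]compf1 -tensm1 -mx_id !tens_sum2 !comp_sum2.
apply: eq_sum2 => i; rewrite !tens_sum2 !comp_sum2.
by apply: eq_sum2 => j; rewrite !tens_compr !compA E.
Qed.

Lemma mx_ext_tensl (Y X : D) (f g : hom (mx ⊗ Y) X) : rdistr bp Y ->
  (forall i j, f \o (inj i j ⊗ idm Y) = g \o (inj i j ⊗ idm Y)) -> f = g.
Proof.
move=> Yr E; rewrite -[f]compf1 -[g]compf1 -tensm1 -mx_id !sum2_tens // !comp_sum2.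
apply: eq_sum2 => i; rewrite !sum2_tens // !comp_sum2.
by apply: eq_sum2 => j; rewrite !tens_compl !compA E.
Qed.

Lemma mx_id2 :
  sum2 (fun i => sum2 (fun j => sum2 (fun k => sum2 (fun l =>
    (inj i j ⊗ inj k l) \o (inj i j ⊗ inj k l)^†)))) = idm (mx ⊗ mx).
Proof.
have mxr := mx_rdistr.
rewrite -tensm1 -{1}mx_id sum2_tens //; apply: eq_sum2 => i.
rewrite sum2_tens //; apply: eq_sum2 => j.
rewrite -[in RHS]mx_id tens_sum2; apply: eq_sum2 => k.
by rewrite tens_sum2; apply: eq_sum2 => l; rewrite dag_tensm -tensmM.
Qed.

Lemma mx_ext2 (X : D) (f g : hom (mx ⊗ mx) X) :
  (forall i j k l, f \o (inj i j ⊗ inj k l) = g \o (inj i j ⊗ inj k l)) -> f = g.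
Proof.
move=> E; rewrite -[f]compf1 -[g]compf1 -mx_id2.
by do 4![rewrite !comp_sum2; apply: eq_sum2 => ?]; rewrite !compA E.
Qed.

Lemma mx_ext3 (X : D) (f g : hom (mx ⊗ mx ⊗ mx) X) :
  (forall i j k l m n, f \o (inj i j ⊗ inj k l ⊗ inj m n)
                       = g \o (inj i j ⊗ inj k l ⊗ inj m n)) -> f = g.
Proof.
have ext (Y : D) (f' g' : hom (mx ⊗ mx ⊗ Y) X) : rdistr bp Y ->
    (forall i j k l, f' \o (inj i j ⊗ inj k l ⊗ idm Y)
                     = g' \o (inj i j ⊗ inj k l ⊗ idm Y)) -> f' = g'.
  move=> Yr E; rewrite -[f']compf1 -[g']compf1 -tensm1 -mx_id2.
  do 4![rewrite !sum2_tens // !comp_sum2; apply: eq_sum2 => ?].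
  by rewrite tens_compl !compA E.
move=> E; apply: mx_ext_tensr => m n; apply: ext => // i j k l.
by rewrite -!compA -tensmM comp1f compf1 E.
Qed.

End MatrixAlgebra.

Arguments sum2_pick {D bp A B} i {F}.

(** * The Frobenius monoid of matrices over a family of blocks *)

Section FrobeniusMatrices.
Variables (D : monoidal_dagger_category) (bp : dagger_biproducts D).
Hypothesis distr : distributive bp.
Variable F : frobenius_blocks D.
Hypothesis F_rdistr : forall i j, rdistr bp (blk F i j).
Notation zero := (zerom bp).
Notation mx := (mx bp (blk F)).
Notation inj := (inj bp (blk F)).
Notation sum2 := (sum2 bp).

Definition mmul : hom (mx ⊗ mx) mx :=
  sum2 (fun i => sum2 (fun j => sum2 (fun k =>
    inj i k \o bmul F i j k \o (inj i j ⊗ inj j k)^†))).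

Definition munit : hom 𝟙 mx := sum2 (fun i => inj i i \o bunit F i).

Definition mcup : hom 𝟙 (mx ⊗ mx) :=
  sum2 (fun j => sum2 (fun k => (inj k j ⊗ inj j k) \o bcup F k j)).

Let inj1 := @inj_id D bp (blk F).
Let injr := @inj_row D bp (blk F).
Let injc := @inj_col D bp (blk F).
Let mxr := mx_rdistr distr F_rdistr.

Lemma mmul_inj i j k : mmul \o (inj i j ⊗ inj j k) = inj i k \o bmul F i j k.
Proof.
have E i' j' k' : (inj i' j' ⊗ inj j' k')^† \o (inj i j ⊗ inj j k)
    = ((inj i' j')^† \o inj i j) ⊗ ((inj j' k')^† \o inj j k).
  by rewrite dag_tensm tensmM.
rewrite /mmul sum2_comp (sum2_pick i).
  by rewrite sum2_comp /sum2 !addm_comp -!compA !E !injr !tens0m // !compm0 !addm0.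
rewrite sum2_comp (sum2_pick j).
  by rewrite /sum2 !addm_comp -!compA !E !injc !tens0m // !compm0 addm0.
rewrite sum2_comp (sum2_pick k); last by rewrite -compA E !inj1 tensm1 compf1.
by rewrite -compA E injc tensm0 // compm0.
Qed.

Lemma mmul_inj0 i j l : mmul \o (inj i j ⊗ inj (negb j) l) = zero _ _.
Proof.
have E i' j' k' : (inj i' j' ⊗ inj j' k')^† \o (inj i j ⊗ inj (negb j) l) = zero _ _.
  rewrite dag_tensm -tensmM.
  have [->|->] := eq_or_negb j j'; last by rewrite injc tens0m.
  by rewrite inj_row' tensm0.
by rewrite /mmul /sum2 !addm_comp -!compA !E !compm0 !addm0.
Qed.

Lemma mmul_injl i j k (A : D) (f : hom A (blk F i j)) :
  mmul \o ((inj i j \o f) ⊗ inj j k) = inj i k \o bmul F i j k \o (f ⊗ idm _).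
Proof. by rewrite -mmul_inj -(compA mmul) -tensmM compf1. Qed.

Lemma mmul_injr i j k (A : D) (f : hom A (blk F j k)) :
  mmul \o (inj i j ⊗ (inj j k \o f)) = inj i k \o bmul F i j k \o (idm _ ⊗ f).
Proof. by rewrite -mmul_inj -(compA mmul) -tensmM compf1. Qed.

Lemma mmul_injl0 i j k (A : D) (f : hom A (blk F i j)) :
  mmul \o ((inj i j \o f) ⊗ inj (negb j) k) = zero _ _.
Proof.
by rewrite -[inj (negb j) k]compf1 tensmM (compA mmul) mmul_inj0 comp0m.
Qed.

Lemma mmul_injr0 i j k (A : D) (f : hom A (blk F (negb j) k)) :
  mmul \o (inj i j ⊗ (inj (negb j) k \o f)) = zero _ _.
Proof.
by rewrite -[inj i j]compf1 tensmM (compA mmul) mmul_inj0 comp0m.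
Qed.

Lemma mmulA : mmul \o (mmul ⊗ idm mx) = mmul \o (idm mx ⊗ mmul) \o α mx mx mx.
Proof.
move: mmul mmul_inj mmul_inj0 mmul_injl mmul_injr mmul_injl0 mmul_injr0
  => mm E E0 El Er El0 Er0.
apply: mx_ext3 => // i j k l m n.
rewrite -!compA α_natural -tensmM comp1f (compA (idm mx ⊗ mm)) -tensmM comp1f.
(* Both bracketings vanish unless both pairs of inner indices match, and then the claim is
   associativity of the blocks. *)
have [->|->] := eq_or_negb j k; have [->|->] := eq_or_negb l m.
- by rewrite !E (compA mm) Er El -!compA (compA (bmul F i j n)) -bmulA.
- by rewrite E E0 El0 tensm0 // comp0m compm0.
- by rewrite E E0 (compA mm) Er0 tens0m // comp0m compm0.
- by rewrite !E0 tensm0 // tens0m // comp0m !compm0.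
Qed.

Lemma mmul1l : mmul \o (munit ⊗ idm mx) = λ mx.
Proof.
move: mmul mmul_injl mmul_injl0 => mm E E0.
apply: mx_ext_tensr => // k l.
rewrite -compA -tensmM comp1f compf1 /munit sum2_tens // comp_sum2 (sum2_pick k).
  by have := E0 _ _ l _ (bunit F (negb k)); rewrite Bool.negb_involutive.
by rewrite E -compA bmul1l λ_natural.
Qed.

Lemma mmul1r : mmul \o (idm mx ⊗ munit) = ρ mx.
Proof.
move: mmul mmul_injr mmul_injr0 => mm E E0.
(* Tensoring with [𝟙] is naturally isomorphic to the identity, so it preserves sums and zeros. *)
have unit_rdistr : rdistr bp (𝟙 : D).
  have E' A B (f : hom A B) : f ⊗ idm 𝟙 = (ρ B)^† \o f \o ρ A.
    by rewrite -compA -ρ_natural compA ρVρ comp1f.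
  split=> [A B f g|A B]; rewrite !E'; first by rewrite comp_addm addm_comp.
  by rewrite compm0 comp0m.
apply: mx_ext_tensl => // k l.
rewrite -compA -tensmM comp1f compf1 /munit tens_sum2 // comp_sum2 (sum2_pick l).
  exact: E0.
by rewrite E -compA bmul1r ρ_natural.
Qed.

(** Each diagonal entry receives its unit once for each of the two intermediate indices. *)
Lemma mmul_cup : mmul \o mcup = addm bp munit munit.
Proof.
rewrite /mcup comp_sum2 -/(sum2 (fun _ => munit)); apply: eq_sum2 => j.
rewrite comp_sum2; apply: eq_sum2 => k.
by rewrite compA mmul_inj -compA bmul_cup.
Qed.

Lemma mmul_dag_inj i l :
  mmul^† \o inj i l = sum2 (fun j => (inj i j ⊗ inj j l) \o (bmul F i j l)^†).
Proof.
have E i' j' k' :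
    (inj i' k' \o bmul F i' j' k' \o (inj i' j' ⊗ inj j' k')^†)^† \o inj i l
    = (inj i' j' ⊗ inj j' k') \o (bmul F i' j' k')^† \o ((inj i' k')^† \o inj i l).
  by rewrite !dagM dagK -!compA.
rewrite /mmul dag_sum2 sum2_comp (sum2_pick i).
  by rewrite /sum2 !dag_addm !addm_comp !E !injr !compm0 !addm0.
rewrite dag_sum2 sum2_comp; apply: eq_sum2 => j.
rewrite dag_sum2 sum2_comp (sum2_pick l); last by rewrite E inj1 compf1.
by rewrite E injc compm0.
Qed.

Lemma mmul_dag :
  mmul^† = (mmul ⊗ idm mx) \o (α mx mx mx)^† \o (idm mx ⊗ mcup) \o (ρ mx)^†.
Proof.
apply: mx_ext => i l; rewrite mmul_dag_inj.
move: mmul mmul_inj mmul_inj0 => mm E E0.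
rewrite -!compA ρV_natural (compA (idm mx ⊗ mcup)) tens_swap -(compA _ (idm _ ⊗ mcup)).
rewrite /mcup tens_sum2 // !(sum2_comp, comp_sum2); apply: eq_sum2 => j.
have H k : (mm ⊗ idm mx) \o ((α mx mx mx)^† \o ((inj i l ⊗ idm (mx ⊗ mx))
      \o ((idm (blk F i l) ⊗ ((inj k j ⊗ inj j k) \o bcup F k j)) \o (ρ (blk F i l))^†)))
    = ((mm \o (inj i l ⊗ inj k j)) ⊗ inj j k) \o (α _ _ _)^†
      \o (idm (blk F i l) ⊗ bcup F k j) \o (ρ (blk F i l))^†.
  rewrite (compA (inj i l ⊗ _)) -tensmM compf1 comp1f -[inj i l in LHS]compf1 tensmM.
  by rewrite !compA -(compA (mm ⊗ _)) αV_natural !compA -tensmM comp1f.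
rewrite tens_sum2 // !(sum2_comp, comp_sum2) (sum2_pick l).
  by rewrite H E0 tens0m // !comp0m.
rewrite H E bmul_dag !compA; do 3 congr (_ \o _).
by rewrite -tensmM compf1.
Qed.

Definition mx_frob2 : frob2 mx := frob2_of_adjoint mmulA mmul1l mmul1r mmul_dag.

Lemma mx_special : (forall (A B : D) (f : hom A B), addm bp f f = f) -> special mx_frob2.
Proof. by move=> idem; apply: special_of_adjoint; rewrite mmul_cup idem. Qed.

End FrobeniusMatrices.

(** * Linking algebras *)

(** The map p of the construction: the operator t(x, y, -), bent into [X ⊗ Y] by the cup [e^†]. *)
Definition tproj (D : monoidal_dagger_category) (X Y : D)
    (e : hom (X ⊗ Y) 𝟙) (t : hom (X ⊗ Y ⊗ X) X) : hom (X ⊗ Y) (X ⊗ Y) :=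
  (t ⊗ idm Y) \o (α (X ⊗ Y) X Y)^† \o (idm (X ⊗ Y) ⊗ e^†) \o (ρ (X ⊗ Y))^†.

Lemma tprojE (D : monoidal_dagger_category) (X Y P Q R : D)
    (e : hom (X ⊗ Y) 𝟙) (t : hom (X ⊗ Y ⊗ X) X) (a : el X P Q) (b : el Y Q R) :
  tproj e t • a ⊡ b = (t • a ⊡ b ⊡ cupl e^† R) ⊡ cupr Y R.
Proof. by rewrite !elE. Qed.

(* A ternary algebra on a dual pair [X0, X1] with the opposite ternary operation
   [t1], and splittings [L0], [L1] of the projections onto the left and right
   multiplication operators.  The record is symmetric under [flip]. *)
Record linking (D : monoidal_dagger_category) := Linking {
  X0 : D; X1 : D; L0 : D; L1 : D;
  e0 : hom (X0 ⊗ X1) 𝟙; e1 : hom (X1 ⊗ X0) 𝟙;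
  t0 : hom (X0 ⊗ X1 ⊗ X0) X0; t1 : hom (X1 ⊗ X0 ⊗ X1) X1;
  s0 : hom L0 (X0 ⊗ X1); s1 : hom L1 (X1 ⊗ X0);
  zig0 : λ X0 \o (e0 ⊗ idm X0) \o (α X0 X1 X0)^† \o (idm X0 ⊗ e1^†) \o (ρ X0)^†
         = idm X0;
  zig1 : λ X1 \o (e1 ⊗ idm X1) \o (α X1 X0 X1)^† \o (idm X1 ⊗ e0^†) \o (ρ X1)^†
         = idm X1;
  tA0 : forall P Q R S T U (a : el X0 P Q) (b : el X1 Q R) (c : el X0 R S)
      (d : el X1 S T) (e : el X0 T U),
    t0 • a ⊡ b ⊡ (t0 • c ⊡ d ⊡ e) = t0 • (t0 • a ⊡ b ⊡ c) ⊡ d ⊡ e;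
  tA1 : forall P Q R S T U (a : el X1 P Q) (b : el X0 Q R) (c : el X1 R S)
      (d : el X0 S T) (e : el X1 T U),
    t1 • a ⊡ b ⊡ (t1 • c ⊡ d ⊡ e) = t1 • (t1 • a ⊡ b ⊡ c) ⊡ d ⊡ e;
  tM0 : forall P Q R S T U (a : el X0 P Q) (b : el X1 Q R) (c : el X0 R S)
      (d : el X1 S T) (e : el X0 T U),
    t0 • a ⊡ (t1 • b ⊡ c ⊡ d) ⊡ e = t0 • (t0 • a ⊡ b ⊡ c) ⊡ d ⊡ e;
  tM1 : forall P Q R S T U (a : el X1 P Q) (b : el X0 Q R) (c : el X1 R S)
      (d : el X0 S T) (e : el X1 T U),
    t1 • a ⊡ (t0 • b ⊡ c ⊡ d) ⊡ e = t1 • (t1 • a ⊡ b ⊡ c) ⊡ d ⊡ e;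
  tl0 : forall P Q (a : el X0 P Q), t0 • cupl e0^† P ⊡ cupr X1 P ⊡ a = a;
  tl1 : forall P Q (a : el X1 P Q), t1 • cupl e1^† P ⊡ cupr X0 P ⊡ a = a;
  tr0 : forall P Q (a : el X0 P Q), t0 • a ⊡ cupl e1^† Q ⊡ cupr X0 Q = a;
  tr1 : forall P Q (a : el X1 P Q), t1 • a ⊡ cupl e0^† Q ⊡ cupr X1 Q = a;
  iso0 : isometry s0;
  iso1 : isometry s1;
  split0 : tproj e0 t0 = s0 \o s0^†;
  split1 : tproj e1 t1 = s1 \o s1^† }.

Definition flip (D : monoidal_dagger_category) (M : linking D) : linking D :=
  Linking (zig1 M) (zig0 M) (@tA1 _ M) (@tA0 _ M) (@tM1 _ M) (@tM0 _ M)
    (@tl1 _ M) (@tl0 _ M) (@tr1 _ M) (@tr0 _ M) (iso1 M) (iso0 M)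
    (split1 M) (split0 M).

Section LinkingAlgebra.
Variables (D : monoidal_dagger_category) (M : linking D).
Notation X0 := (X0 M). Notation X1 := (X1 M).
Notation L0 := (L0 M). Notation L1 := (L1 M).
Notation e0 := (e0 M). Notation e1 := (e1 M).
Notation t0 := (t0 M). Notation t1 := (t1 M).
Notation s0 := (s0 M). Notation s1 := (s1 M).
Notation p0 := (tproj e0 t0).

Lemma zag0 : ρ X0 \o (idm X0 ⊗ e1) \o α X0 X1 X0 \o (e0^† ⊗ idm X0) \o (λ X0)^†
  = idm X0.
Proof.
by have := f_equal dag (zig0 M); rewrite !dagM !dag_tensm !dagK !dag1 !compA.
Qed.

Lemma zig_el P Q (a : el X0 P Q) :
  scl (e0 • a ⊡ cupl e1^† Q) (cupr X0 Q) = a.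
Proof. by rewrite -[RHS]act_id -zig0 !elE. Qed.

Lemma zag_el P Q (a : el X0 P Q) :
  scr (cupl e0^† P) (e1 • cupr X1 P ⊡ a) = a.
Proof. by rewrite -[RHS]act_id -zag0 !elE. Qed.

Lemma tproj_dag : p0^† = p0.
Proof. by rewrite split0 dagM dagK. Qed.

Lemma s_dag_tproj : s0^† \o p0 = s0^†.
Proof. by rewrite split0 compA iso0 comp1f. Qed.

Lemma tproj_s : p0 \o s0 = s0.
Proof. by rewrite split0 -compA iso0 compf1. Qed.

(** The representative is [s0 • x] itself, hence fixed by the projection. Elements of [L0] can thus
    be handled as products of elements of [X0] and [X1]. *)
Lemma left_op_surj P Q (x : el L0 P Q) :
  exists S (a : el X0 P S) (b : el X1 S Q), x = s0^† • a ⊡ b /\ s0 • x = a ⊡ b.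
Proof.
have [S [a [b E]]] := tensel_surj (s0 • x); exists S, a, b; split=> //.
by rewrite -E -act_comp iso0 act_id.
Qed.

Lemma s_s_dag P Q (z : el (X0 ⊗ X1) P Q) : s0 • s0^† • z = p0 • z.
Proof. by rewrite -act_comp -split0. Qed.

(** The cup created by the projection is absorbed by associativity and the left unit law. *)
Lemma t_tproj P Q R (z : el (X0 ⊗ X1) P Q) (x : el X0 Q R) :
  t0 • (p0 • z) ⊡ x = t0 • z ⊡ x.
Proof.
by have [S [a [b ->]]] := tensel_surj z; rewrite tprojE -tA0 tl0.
Qed.

(** Both sides name the same left multiplication operator: after the projection this is the mixed
    law [tM0]. *)
Lemma s_dag_shift P Q R S T (a : el X0 P Q) (b : el X1 Q R) (c : el X0 R S)
    (d : el X1 S T) :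
  s0^† • (t0 • a ⊡ b ⊡ c) ⊡ d = s0^† • a ⊡ (t1 • b ⊡ c ⊡ d).
Proof. by rewrite -s_dag_tproj !(act_comp s0^†) !tprojE tM0. Qed.

(** [t0] evaluates the projected operator on its third argument, as [E] says; the projection is
    self-adjoint, so the dagger can be read off. *)
Lemma t_dag : t0^† = (p0 ⊗ idm X0) \o (α X0 X1 X0)^† \o (idm X0 ⊗ e1^†) \o (ρ X0)^†.
Proof.
have E : t0 = ρ X0 \o (idm X0 ⊗ e1) \o α X0 X1 X0 \o (p0 ⊗ idm X0).
  apply: act_inj3 => P Q R S a b c.
  have pE := tprojE e0 t0 a b; move: (tproj _ _) pE => p pE; rewrite !elE pE !elE.
  by rewrite -{1}(zag_el c) -scr_tens act_scr.
by rewrite {1}E !dagM !dag_tensm tproj_dag !dag1 !compA.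
Qed.

Definition mulLL : hom (L0 ⊗ L0) L0 :=
  s0^† \o (t0 ⊗ idm X1) \o (α (X0 ⊗ X1) X0 X1)^† \o (s0 ⊗ s0).
Definition mulLX : hom (L0 ⊗ X0) X0 := t0 \o (s0 ⊗ idm X0).
Definition mulXX : hom (X0 ⊗ X1) L0 := s0^†.
Definition mulXL : hom (X0 ⊗ L1) X0 := t0 \o (α X0 X1 X0)^† \o (idm X0 ⊗ s1).
Definition unitL : hom 𝟙 L0 := s0^† \o e0^†.
(** The cup [e1^†] nested inside the cup [e0^†], with each half projected to [L0]. *)
Definition cupL : hom 𝟙 (L0 ⊗ L0) :=
  (s0^† ⊗ s0^†) \o α (X0 ⊗ X1) X0 X1 \o ((α X0 X1 X0)^† ⊗ idm X1)
    \o ((idm X0 ⊗ e1^†) ⊗ idm X1) \o ((ρ X0)^† ⊗ idm X1) \o e0^†.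

Lemma mulLXE P Q R S (a : el X0 P Q) (b : el X1 Q R) (c : el X0 R S) :
  mulLX • (s0^† • a ⊡ b) ⊡ c = t0 • a ⊡ b ⊡ c.
Proof. by rewrite !elE s_s_dag t_tproj. Qed.

Lemma mulLLE P Q R S T (a : el X0 P Q) (b : el X1 Q R) (c : el X0 R S)
    (d : el X1 S T) :
  mulLL • (s0^† • a ⊡ b) ⊡ (s0^† • c ⊡ d) = s0^† • (t0 • a ⊡ b ⊡ c) ⊡ d.
Proof.
rewrite !elE !s_s_dag (tprojE _ _ c d) act_αV act_tens act_id t_tproj tA0.
by rewrite -tprojE -act_comp s_dag_tproj.
Qed.

End LinkingAlgebra.

Lemma mulXLE (D : monoidal_dagger_category) (M : linking D) P Q R S
    (a : el (X0 M) P Q) (b : el (X1 M) Q R) (c : el (X0 M) R S) :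
  mulXL M • a ⊡ ((s1 M)^† • b ⊡ c) = t0 M • a ⊡ b ⊡ c.
Proof.
rewrite !elE (@s_s_dag _ (flip M)) tprojE act_αV /= tM0.
by rewrite tr0.
Qed.

Lemma unitLE (D : monoidal_dagger_category) (M : linking D) P :
  unitL M • one P = (s0 M)^† • cupl (e0 M)^† P ⊡ cupr (X1 M) P.
Proof. by rewrite !elE. Qed.

Lemma t_dagE (D : monoidal_dagger_category) (M : linking D) P Q (a : el (X0 M) P Q) :
  (t0 M)^† • a
  = (tproj (e0 M) (t0 M) • a ⊡ cupl (e1 M)^† Q) ⊡ cupr (X0 M) Q.
Proof. by rewrite t_dag; move: (tproj _ _) => p; rewrite !elE. Qed.

Lemma s_dag_tprojE (D : monoidal_dagger_category) (M : linking D) P Q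
    (z : el (X0 M ⊗ X1 M) P Q) :
  (s0 M)^† • tproj (e0 M) (t0 M) • z = (s0 M)^† • z.
Proof. by rewrite -act_comp s_dag_tproj. Qed.

(** * The four blocks of the linking algebra and their Frobenius laws *)

Section LinkingBlocks.
Variables (D : monoidal_dagger_category).
Implicit Types M : linking D.

Definition lblk M (i j : bool) : D :=
  match i, j with
  | false, false => L0 M | false, true => X0 M
  | true, false => X1 M | true, true => L1 M
  end.

Definition lmul M (i j k : bool) : hom (lblk M i j ⊗ lblk M j k) (lblk M i k) :=
  match i, j, k with
  | false, false, false => mulLL M | false, false, true => mulLX M
  | false, true, false => mulXX M | false, true, true => mulXL M
  | true, true, true => mulLL (flip M) | true, true, false => mulLX (flip M)
  | true, false, true => mulXX (flip M) | true, false, false => mulXL (flip M)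
  end.

Definition lunit M (i : bool) : hom 𝟙 (lblk M i i) :=
  match i with false => unitL M | true => unitL (flip M) end.

Definition lcup M (i j : bool) : hom 𝟙 (lblk M i j ⊗ lblk M j i) :=
  match i, j with
  | false, false => cupL M | false, true => (e0 M)^†
  | true, false => (e1 M)^† | true, true => cupL (flip M)
  end.

(** Row [true] will follow by [flip]. Once elements of [L0] and [L1] are written as products, the
    eight cases follow from the ternary associativity laws and [s_dag_shift]. *)
Lemma lmulA0 M j k l :
  lmul M false k l \o (lmul M false j k ⊗ idm _)
  = lmul M false j l \o (idm _ ⊗ lmul M j k l) \o α _ _ _.
Proof.
have LL := @mulLLE D M; have LX := @mulLXE D M; have XL := @mulXLE D M.
have LL' := @mulLLE D (flip M); have LX' := @mulLXE D (flip M).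
have XL' := @mulXLE D (flip M).
have sh := @s_dag_shift D M.
have LXX (P Q : D) (x : el (L0 M) P Q) :
    exists S (a : el (X0 M) P S) (b : el (X1 M) S Q), x = (s0 M)^† • a ⊡ b.
  by have [S [a [b [-> _]]]] := left_op_surj x; exists S, a, b.
have LXX' (P Q : D) (x : el (L1 M) P Q) :
    exists S (a : el (X1 M) P S) (b : el (X0 M) S Q), x = (s1 M)^† • a ⊡ b.
  by have [S [a [b [-> _]]]] := @left_op_surj D (flip M) P Q x; exists S, a, b.
have tA := @tA0 D M; have tM := @tM0 D M.
have tA' := @tA1 D M; have tM' := @tM1 D M.
rewrite /lmul /mulXX /=.
move: (mulLL M) (mulLX M) (mulXL M) LL LX XL => mLL mLX mXL LL LX XL.
move: (mulLL (flip M)) (mulLX (flip M)) (mulXL (flip M)) LL' LX' XL'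
  => /= mLL' mLX' mXL' LL' LX' XL'.
have simp := (act_comp, act_tens, act_α, act_id).
by case: j; case: k; case: l; apply: act_inj3 => P Q R S x y z; rewrite !simp;
  repeat match goal with
  | x : el (lblk M _ _) _ _ |- _ => rewrite /= in x *
  | x : el (L0 M) _ _ |- _ => let a := fresh in let b := fresh in
      have [? [a [b ->]]] := LXX _ _ x; clear x
  | x : el (L1 M) _ _ |- _ => let a := fresh in let b := fresh in
      have [? [a [b ->]]] := LXX' _ _ x; clear x
  end; rewrite ?(LL, LX, XL, LL', LX', XL') ?sh ?(tA, tM, tA', tM').
Qed.

Lemma lmulA M i j k l :
  lmul M i k l \o (lmul M i j k ⊗ idm _)
  = lmul M i j l \o (idm _ ⊗ lmul M j k l) \o α _ _ _.
Proof.
case: i; last exact: lmulA0.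
by move: (@lmulA0 (flip M) (negb j) (negb k) (negb l)); case: j; case: k; case: l.
Qed.

Lemma lmul1l M i j : lmul M i i j \o (lunit M i ⊗ idm _) = λ _.
Proof.
suff E M' j' : lmul M' false false j' \o (lunit M' false ⊗ idm _) = λ _.
  by case: i; [move: (E (flip M) (negb j)); case: j|exact: E].
case: j' => /=; apply: act_injl => P Q a; rewrite act_comp act_tens act_id unitLE act_λ.
  by rewrite mulLXE tl0.
have [S [b [c [-> _]]]] := left_op_surj a.
by rewrite mulLLE tl0.
Qed.

Lemma lmul1r M i j : lmul M i j j \o (idm _ ⊗ lunit M j) = ρ _.
Proof.
suff E M' j' : lmul M' false j' j' \o (idm _ ⊗ lunit M' j') = ρ _.
  by case: i; [move: (E (flip M) (negb j)); case: j|exact: E].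
case: j' => /=; apply: act_injr => P Q a; rewrite act_comp act_tens act_id.
  by rewrite (@unitLE _ (flip M')) act_ρ mulXLE; apply: tr0.
rewrite unitLE act_ρ.
have [S [b [c [-> _]]]] := left_op_surj a.
by rewrite mulLLE -tprojE -act_comp s_dag_tproj.
Qed.

Lemma cupLE M P : cupL M • one P
  = ((s0 M)^† • cupl (e0 M)^† P ⊡ cupl (e1 M)^† (X1 M ⊗ P))
    ⊡ ((s0 M)^† • cupr (X0 M) (X1 M ⊗ P) ⊡ cupr (X1 M) P).
Proof. by rewrite /cupL !elE. Qed.

Lemma mulLL_dag M : (mulLL M)^†
  = (mulLL M ⊗ idm _) \o (α _ _ _)^† \o (idm _ ⊗ cupL M) \o (ρ _)^†.
Proof.
apply: act_inj => P Q x; have [S [a [b [-> _]]]] := left_op_surj x.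
have -> : (mulLL M)^† = ((s0 M)^† ⊗ (s0 M)^†) \o α _ _ _ \o ((t0 M)^† ⊗ idm _) \o s0 M.
  by rewrite !dagM !dag_tensm !dagK dag1 !compA.
rewrite !(act_comp _ (s0 M)) s_s_dag tprojE !act_comp !act_tens act_id t_dagE act_α act_tens.
rewrite s_dag_tprojE act_ρV act_tens cupLE act_id act_αV act_tens mulLLE act_id.
by [].
Qed.

Lemma lmul_dag M i j k :
  (lmul M i j k)^†
  = (lmul M i k j ⊗ idm _) \o (α _ _ _)^† \o (idm _ ⊗ lcup M k j) \o (ρ _)^†.
Proof.
suff E M' j' k' : (lmul M' false j' k')^†
  = (lmul M' false k' j' ⊗ idm _) \o (α _ _ _)^† \o (idm _ ⊗ lcup M' k' j') \o (ρ _)^†.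
  by case: i; [move: (E (flip M) (negb j) (negb k)); case: j; case: k|exact: E].
case: j'; case: k' => /=; last exact: mulLL_dag.
- apply: act_inj => P Q a.
  have -> : (mulXL M')^† = (idm _ ⊗ (s1 M')^†) \o α _ _ _ \o (t0 M')^†.
    by rewrite !dagM !dag_tensm !dagK dag1 !compA.
  rewrite !act_comp act_ρV act_tens (@cupLE (flip M')) /= act_αV act_tens !act_id mulXLE.
  by rewrite t_dagE tprojE act_α act_tens act_id.
- apply: act_inj => P Q a; rewrite /mulXX dagK !act_comp act_ρV act_tens act_cup act_αV.
  have [S [b [c [_ E]]]] := left_op_surj a.
  by rewrite act_tens !act_id !act_comp act_tens act_id E -tprojE -E -act_comp tproj_s.
- apply: act_inj => P Q a.
  have -> : (mulLX M')^† = ((s0 M')^† ⊗ idm _) \o (t0 M')^†.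
    by rewrite !dagM !dag_tensm dag1.
  by rewrite !act_comp act_ρV t_dagE !act_tens act_cup act_αV act_tens s_dag_tprojE !act_id.
Qed.

Lemma lmul_cup M i j : lmul M i j i \o lcup M i j = lunit M i.
Proof.
suff E M' j' : lmul M' false j' false \o lcup M' false j' = lunit M' false.
  by case: i; [move: (E (flip M) (negb j)); case: j|exact: E].
case: j' => //=; apply: act_inj_one => P.
by rewrite act_comp cupLE mulLLE tr0 unitLE.
Qed.

Definition lblocks M : frobenius_blocks D :=
  FrobeniusBlocks (lmulA M) (lmul1l M) (lmul1r M) (lmul_dag M) (lmul_cup M).

End LinkingBlocks.

(** * The linking algebra of a normal 3-structure *)

Section LinkingOfFrob3.
Variables (D : monoidal_dagger_category) (A : normal_frob3 D).
Notation m := (nter A).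
Notation A' := (dual A).
Notation e := (ε A).
Notation h := (η A).
Notation p := (tproj e m).

Lemma nterA P Q R S T U (a : el A P Q) (b : el A' Q R) (c : el A R S)
    (d : el A' S T) (x : el A T U) :
  m • a ⊡ b ⊡ (m • c ⊡ d ⊡ x) = m • (m • a ⊡ b ⊡ c) ⊡ d ⊡ x.
Proof.
by have := f_equal (fun f => f • a ⊡ b ⊡ c ⊡ d ⊡ x) (terA (n3_frob A)); rewrite !elE.
Qed.

Lemma nter_dagl P Q (a : el A P Q) : m^† • a = (p • a ⊡ cupl h Q) ⊡ cupr A Q.
Proof. by rewrite -ter_frobenius_l !elE. Qed.

Lemma nter_dagr P Q (a : el A P Q) :
  m^† • a = cupl e^† P ⊡ cupl h (A' ⊗ P)
            ⊡ (m • cupr A (A' ⊗ P) ⊡ cupr A' P ⊡ a).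
Proof. by rewrite /nter ter_frobenius_r !elE. Qed.

Lemma nter_unitl P Q (a : el A P Q) : m • cupl e^† P ⊡ cupr A' P ⊡ a = a.
Proof.
by have [/(f_equal (fun f => f • a)) + _] := n3_normal A; rewrite !elE.
Qed.

Lemma nter_unitr P Q (a : el A P Q) : m • a ⊡ cupl h Q ⊡ cupr A Q = a.
Proof.
by have [_ /(f_equal (fun f => f • a))] := n3_normal A; rewrite !elE.
Qed.

Lemma snake1_el P Q (a : el A P Q) : scl (e • a ⊡ cupl h Q) (cupr A Q) = a.
Proof. by rewrite -[RHS]act_id -(snake1 A) !elE. Qed.

Lemma snake2_el P Q (a : el A' P Q) : scr (cupl h P) (e • cupr A P ⊡ a) = a.
Proof. by rewrite -[RHS]act_id -(snake2 A) !elE. Qed.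

Lemma snake2_dag_el P Q (a : el A' P Q) :
  scl (h^† • a ⊡ cupl e^† Q) (cupr A' Q) = a.
Proof.
have := f_equal dag (snake2 A); rewrite !dagM !dag_tensm !dagK !dag1.
by move=> /(f_equal (fun f => f • a)); rewrite !elE.
Qed.

Lemma pairing_inj P Q (y y' : el A' P Q) :
  (forall S (x : el A S P), e • x ⊡ y = e • x ⊡ y') -> y = y'.
Proof. by move=> E; rewrite -[y]snake2_el E snake2_el. Qed.

(** The first Frobenius law expresses [m^†] through the projection. Bending the last leg with [ε]
    yields the dagger of the projection on one side and, by a snake identity, the projection on the
    other. *)
Lemma tproj_nter_dag : p^† = p.
Proof.
have E : p^† = ρ _ \o (idm _ ⊗ e) \o α _ _ _ \o (m^† ⊗ idm _).
  by rewrite /tproj !dagM !dag_tensm !dagK !dag1 !compA.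
apply: act_inj2 => P Q R a b; rewrite {}E.
have := nter_dagl a; move: (tproj _ _) (m^†) => pr mt mtE.
by rewrite !elE mtE !elE -/(scr _ _) -act_scr -{2}(snake2_el b) scr_tens.
Qed.

(** The second Frobenius law gives a formula for the projection in which [a] and [b] enter only
    through a pairing, so that operators can be compared by pairings. *)
Lemma tproj_nterE P Q R (a : el A P Q) (b : el A' Q R) :
  p • a ⊡ b
  = cupl e^† P ⊡ scr (cupl h (A' ⊗ P)) (e • (m • cupr A (A' ⊗ P) ⊡ cupr A' P ⊡ a) ⊡ b).
Proof.
have E : p^† = ρ _ \o (idm _ ⊗ e) \o α _ _ _ \o (m^† ⊗ idm _).
  by rewrite /tproj !dagM !dag_tensm !dagK !dag1 !compA.
rewrite -tproj_nter_dag {}E; have := nter_dagr a; move: (m^†) => mt mtE.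
by rewrite !elE mtE !elE -scr_tens.
Qed.

(* The ternary operation on the dual, transposed from [m] along the pairing. *)
Definition conter : hom (A' ⊗ A ⊗ A') A' :=
  curry (e \o (m ⊗ idm A') \o ((α A A' A)^† ⊗ idm A') \o (α A (A' ⊗ A) A')^†).
Notation m' := conter.

Lemma pairing_conter P Q R S T (x : el A P Q) (b : el A' Q R) (c : el A R S)
    (d : el A' S T) :
  e • x ⊡ (m' • b ⊡ c ⊡ d) = e • (m • x ⊡ b ⊡ c) ⊡ d.
Proof.
have := f_equal (fun f => f • x ⊡ (b ⊡ c ⊡ d))
  (ε_curry (e \o (m ⊗ idm A') \o ((α A A' A)^† ⊗ idm A') \o (α A (A' ⊗ A) A')^†)).
rewrite -/conter act_comp act_tens act_id => ->.
by rewrite !elE.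
Qed.

(** Inserting the projection reduces the claim to an equality of operators, which [tproj_nterE]
    reduces to pairings. There [m'] unfolds and associativity of [m] remains. *)
Lemma conter_mixed P Q R S T U (a : el A P Q) (b : el A' Q R) (c : el A R S)
    (d : el A' S T) (x : el A T U) :
  m • a ⊡ (m' • b ⊡ c ⊡ d) ⊡ x = m • (m • a ⊡ b ⊡ c) ⊡ d ⊡ x.
Proof.
have absorb P' Q' R' (z : el (A ⊗ A') P' Q') (y : el A Q' R') :
    m • (p • z) ⊡ y = m • z ⊡ y.
  by have [S' [z1 [z2 ->]]] := tensel_surj z; rewrite tprojE -nterA nter_unitl.
rewrite -absorb -[RHS]absorb; congr (m • _ ⊡ _).
by rewrite !tproj_nterE pairing_conter nterA.
Qed.

Lemma conterA P Q R S T U (a : el A' P Q) (b : el A Q R) (c : el A' R S)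
    (d : el A S T) (x : el A' T U) :
  m' • a ⊡ b ⊡ (m' • c ⊡ d ⊡ x) = m' • (m' • a ⊡ b ⊡ c) ⊡ d ⊡ x.
Proof. by apply: pairing_inj => P' y; rewrite !pairing_conter conter_mixed. Qed.

Lemma conter_mixed' P Q R S T U (a : el A' P Q) (b : el A Q R) (c : el A' R S)
    (d : el A S T) (x : el A' T U) :
  m' • a ⊡ (m • b ⊡ c ⊡ d) ⊡ x = m' • (m' • a ⊡ b ⊡ c) ⊡ d ⊡ x.
Proof. by apply: pairing_inj => P' y; rewrite !pairing_conter conter_mixed nterA. Qed.

Lemma conter_unitl P Q (a : el A' P Q) : m' • cupl h P ⊡ cupr A P ⊡ a = a.
Proof. by apply: pairing_inj => P' y; rewrite pairing_conter nter_unitr. Qed.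

(** The dagger of this equation says that the projection fixes the cup, which is the left unit
    law. *)
Lemma pairing_tproj : e \o p = e.
Proof.
rewrite -[LHS]dagK dagM tproj_nter_dag -[RHS]dagK; congr (_^†).
by apply: act_inj_one => P; rewrite act_comp act_cup tprojE nter_unitl.
Qed.

Lemma conter_unitr P Q (a : el A' P Q) : m' • a ⊡ cupl e^† Q ⊡ cupr A' Q = a.
Proof.
apply: pairing_inj => P' y; rewrite pairing_conter -tprojE -act_comp.
by rewrite pairing_tproj.
Qed.

(** Transposing [m'] back along the pairing leaves a formula for the opposite projection in terms of
    [m] alone. *)
Lemma tproj_conterE P Q R (b : el A' P Q) (a : el A Q R) :
  tproj h^† m' • b ⊡ a = cupl h P ⊡ (m • cupr A P ⊡ b ⊡ a).
Proof.
rewrite tprojE dagK.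
have -> : m' • b ⊡ a ⊡ cupl h R
    = scr (cupl h P) (e • (m • cupr A P ⊡ b ⊡ a) ⊡ cupl h R).
  by rewrite -pairing_conter snake2_el.
by rewrite -tens_scl snake1_el.
Qed.

(** The formula of [tproj_conterE] contains [m] once, so the second Frobenius law computes its
    dagger; a snake identity restores the original. *)
Lemma tproj_conter_dag : (tproj h^† m')^† = tproj h^† m'.
Proof.
have E : tproj h^† m' = (idm A' ⊗ (m \o (α A A' A)^†)) \o α A' A (A' ⊗ A)
    \o (h ⊗ idm (A' ⊗ A)) \o (λ (A' ⊗ A))^†.
  by apply: act_inj2 => P Q R b a; rewrite tproj_conterE !elE.
have Ed : (tproj h^† m')^† = λ (A' ⊗ A) \o (h^† ⊗ idm (A' ⊗ A))
    \o (α A' A (A' ⊗ A))^† \o (idm A' ⊗ (α A A' A \o m^†)).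
  by rewrite E !dagM !dag_tensm !dagM !dagK !dag1 !compA.
apply: act_inj2 => P Q R b a; rewrite Ed.
have := nter_dagr a; have := @tproj_conterE _ _ _ (cupr A' Q) a.
move: (tproj _ _) (m^†) => q mt qE mtE.
rewrite !elE mtE act_α -qE act_αV act_tens act_id -/(scl _ _).
by rewrite -act_scl -scl_tens snake2_dag_el.
Qed.

Lemma linking_zig0 : λ A \o (e ⊗ idm A) \o (α A A' A)^† \o (idm A ⊗ h^†^†)
  \o (ρ A)^† = idm A.
Proof. by rewrite dagK snake1. Qed.

Lemma linking_zig1 : λ A' \o (h^† ⊗ idm A') \o (α A' A A')^† \o (idm A' ⊗ e^†)
  \o (ρ A')^† = idm A'.
Proof.
by have := f_equal dag (snake2 A); rewrite !dagM !dag_tensm !dagK !dag1 !compA.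
Qed.

Lemma linking_unitr P Q (a : el A P Q) : m • a ⊡ cupl h^†^† Q ⊡ cupr A Q = a.
Proof. by rewrite dagK nter_unitr. Qed.

Lemma linking_unitl' P Q (a : el A' P Q) : m' • cupl h^†^† P ⊡ cupr A P ⊡ a = a.
Proof. by rewrite dagK conter_unitl. Qed.

Definition linking_of_frob3 (L L' : D) (s : hom L (A ⊗ A')) (s' : hom L' (A' ⊗ A))
    (iso : isometry s) (split : p = s \o s^†)
    (iso' : isometry s') (split' : tproj h^† m' = s' \o s'^†) : linking D :=
  Linking linking_zig0 linking_zig1 nterA conterA conter_mixed conter_mixed'
    nter_unitl linking_unitl' linking_unitr conter_unitr iso iso' split split'.

(* By the left unit law the projection is right multiplication by the idempotent
   [e^†]. *)
Lemma tproj_nter_idem : dagger_idempotent p.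
Proof.
rewrite /dagger_idempotent tproj_nter_dag; apply: act_inj2 => P Q R a b.
by rewrite act_comp !tprojE -nterA nter_unitl.
Qed.

Lemma tproj_conter_idem : dagger_idempotent (tproj h^† m').
Proof.
rewrite /dagger_idempotent tproj_conter_dag; apply: act_inj2 => P Q R a b.
by rewrite act_comp !tprojE -conterA linking_unitl'.
Qed.

End LinkingOfFrob3.

(** * Morphisms out of a linking algebra *)

Section MonoidTrace.
Variables (D : monoidal_dagger_category) (B : D) (N : frob2 B).
Notation mu := (μ N).
Notation tr := ((u N)^† \o mu).
Notation cup := (mu^† \o u N).

Lemma mul_assoc P Q R S (x : el B P Q) (y : el B Q R) (z : el B R S) :
  mu • (mu • x ⊡ y) ⊡ z = mu • x ⊡ (mu • y ⊡ z).
Proof. by have := f_equal (fun f => f • x ⊡ y ⊡ z) (μA N); rewrite !elE. Qed.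

Lemma mul_onel P Q (x : el B P Q) : mu • (u N • one P) ⊡ x = x.
Proof.
by have := f_equal (fun f => f • one P ⊡ x) (μ1l N); rewrite !elE act_λ.
Qed.

Lemma comul_cup P Q (z : el B P Q) :
  mu^† • z = cupl cup P ⊡ (mu • cupr B P ⊡ z).
Proof.
have := f_equal (fun f => f • (u N • one P) ⊡ z) (μ_frobenius N).
have [R [a [b E]]] := tensel_surj (mu^† • z).
rewrite !act_comp !act_tens act_id E act_αV act_tens act_id => F.
have -> : a ⊡ b = (mu • (u N • one P) ⊡ a) ⊡ b by rewrite mul_onel.
by rewrite F -(act_comp mu^†) act_cup act_α act_tens !act_id.
Qed.

Lemma trace_snake P Q (x : el B P Q) : scl (tr • x ⊡ cupl cup Q) (cupr B Q) = x.
Proof.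
have := f_equal (fun f => f • x) (frob2_snake1 N); move: tr cup => t c.
by rewrite !elE.
Qed.

Lemma trace_snake' P Q (x : el B P Q) : scr (cupl cup P) (tr • cupr B P ⊡ x) = x.
Proof.
have := f_equal (fun f => f • x) (frob2_snake2 N); move: tr cup => t c.
by rewrite !elE.
Qed.

Lemma trace_inj (Z : D) (f g : hom Z B) :
  tr \o (f ⊗ idm B) = tr \o (g ⊗ idm B) -> f = g.
Proof.
move=> E; apply: act_inj => P Q z.
have H P' Q' R' (x : el Z P' Q') (y : el B Q' R') :
    tr • (f • x) ⊡ y = tr • (g • x) ⊡ y.
  have := f_equal (fun f => f • x ⊡ y) E; move: tr => t.
  by rewrite !elE.
by rewrite -[f • z]trace_snake H trace_snake.
Qed.

Lemma trace_mul P Q R S (x : el B P Q) (y : el B Q R) (z : el B R S) :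
  tr • (mu • x ⊡ y) ⊡ z = tr • x ⊡ (mu • y ⊡ z).
Proof. by rewrite !(act_comp (u N)^†) mul_assoc. Qed.

(** The Frobenius law in Sweedler style, with [y1] and [y2] the two legs of the comultiplication of
    [y]. *)
Lemma mul_trace P Q R S (w : el B P Q) (y : el B Q S) (y1 : el B Q R) (y2 : el B R S) :
  mu^† • y = y1 ⊡ y2 -> mu • w ⊡ y = scl (tr • w ⊡ y1) y2.
Proof.
rewrite comul_cup => E.
(* The scalar expression depends only on the composite [a ⊡ b], so another decomposition of
   [mu^† • y] may replace the given one. *)
have H R' (a : el B Q R') (b : el B R' S) :
    scl (tr • w ⊡ a) b = λ B • (tr ⊗ idm B) • (α B B B)^† • w ⊡ (a ⊡ b).
  by rewrite act_αV act_tens act_id.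
rewrite H -E -H -{1}(trace_snake w).
by rewrite scl_tens act_scl.
Qed.

End MonoidTrace.

(** An equality of composites does not split into components, whose stages may even differ; this
    allows its use when the second component sits inside a further product. *)
Lemma tens_act_congr (D : monoidal_dagger_category) (A B C E P Q Q' R S : D)
    (a : el A P Q) (b : el B Q R) (a' : el A P Q') (b' : el B Q' R)
    (f : hom (B ⊗ C) E) (z : el C R S) :
  a ⊡ b = a' ⊡ b' -> a ⊡ (f • b ⊡ z) = a' ⊡ (f • b' ⊡ z).
Proof.
move=> ab; have := f_equal (fun x => (idm A ⊗ f) • α A B C • x ⊡ z) ab.
by rewrite !elE.
Qed.

Section LinkingCyclicity.
Variables (D : monoidal_dagger_category) (M : linking D).
Notation X0 := (X0 M). Notation X1 := (X1 M).
Notation e0 := (e0 M). Notation e1 := (e1 M).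
Notation t0 := (t0 M). Notation t1 := (t1 M).
Notation p0 := (tproj e0 t0). Notation p1 := (tproj e1 t1).

Lemma e_tproj : e0 \o p0 = e0.
Proof.
rewrite -[LHS]dagK dagM tproj_dag -[RHS]dagK; congr (_^†).
by apply: act_inj_one => P; rewrite act_comp act_cup tprojE tl0.
Qed.

(** The pairing does not see the projection, and once the projection is inserted the claim is the
    mixed law [tM0]. *)
Lemma e_cyclic P Q R S T (a : el X0 P Q) (b : el X1 Q R) (c : el X0 R S)
    (d : el X1 S T) :
  e0 • a ⊡ (t1 • b ⊡ c ⊡ d) = e0 • (t0 • a ⊡ b ⊡ c) ⊡ d.
Proof.
rewrite -[in LHS]e_tproj -[in RHS]e_tproj !(act_comp e0) !tprojE.
by rewrite tM0.
Qed.

Lemma tproj_cyclic P Q R (b : el X1 P Q) (a : el X0 Q R) :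
  p1 • b ⊡ a = cupl e1^† P ⊡ (t0 • cupr X0 P ⊡ b ⊡ a).
Proof.
rewrite tprojE.
have -> : t1 • b ⊡ a ⊡ cupl e1^† R
    = scr (cupl e1^† P) (e0 • (t0 • cupr X0 P ⊡ b ⊡ a) ⊡ cupl e1^† R).
  by rewrite -e_cyclic (@zag_el _ (flip M)).
by rewrite -tens_scl zig_el.
Qed.

Lemma t_pair P Q R (z : el (X0 ⊗ X1) P Q) (c : el X0 Q R) :
  t0 • z ⊡ c = ρ X0 • (idm X0 ⊗ e1) • α X0 X1 X0 • (p0 • z) ⊡ c.
Proof.
have [S [a [b ->]]] := tensel_surj z.
by rewrite tprojE act_α act_tens act_id -/(scr _ _) -[in LHS](zag_el c) -scr_tens act_scr.
Qed.

End LinkingCyclicity.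

(** The mirror image of [t_dagE], with the cups on the left, obtained by applying [tproj_cyclic] in
    both orientations. *)
Lemma t_dag_cyclic (D : monoidal_dagger_category) (M : linking D) P Q
    (x : el (X0 M) P Q) :
  α _ _ _ • (t0 M)^† • x
  = cupl (e0 M)^† P ⊡ (cupl (e1 M)^† (X1 M ⊗ P)
      ⊡ (t0 M • cupr (X0 M) (X1 M ⊗ P) ⊡ cupr (X1 M) P ⊡ x)).
Proof.
rewrite t_dagE (@tproj_cyclic _ (flip M)) /= act_α -tprojE.
by rewrite tproj_cyclic.
Qed.

(* A morphism of 2-structures out of the linking algebra, seen on its generators. *)
Record linking_rep (D : monoidal_dagger_category) (bp : dagger_biproducts D)
    (M : linking D) (B : D) (N : frob2 B) := LinkingRep {
  k0 : hom (X0 M) B;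
  k1 : hom (X1 M) B;
  rep_ter0 : forall P Q R S (a : el (X0 M) P Q) (b : el (X1 M) Q R) (c : el (X0 M) R S),
    k0 • t0 M • a ⊡ b ⊡ c = μ N • (μ N • (k0 • a) ⊡ (k1 • b)) ⊡ (k0 • c);
  rep_ter1 : forall P Q R S (a : el (X1 M) P Q) (b : el (X0 M) Q R) (c : el (X1 M) R S),
    k1 • t1 M • a ⊡ b ⊡ c = μ N • (μ N • (k1 • a) ⊡ (k0 • b)) ⊡ (k1 • c);
  rep_sq0 : μ N \o (k0 ⊗ k0) = zerom bp _ _;
  rep_sq1 : μ N \o (k1 ⊗ k1) = zerom bp _ _;
  rep_trace0 : (u N)^† \o μ N \o (k0 ⊗ idm B) = e0 M \o (idm (X0 M) ⊗ k1^†);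
  rep_trace1 : (u N)^† \o μ N \o (k1 ⊗ idm B) = e1 M \o (idm (X1 M) ⊗ k0^†) }.

Definition flip_rep (D : monoidal_dagger_category) (bp : dagger_biproducts D)
    (M : linking D) (B : D) (N : frob2 B) (r : linking_rep bp M N) :
    linking_rep bp (flip M) N :=
  @LinkingRep D bp (flip M) B N (k1 r) (k0 r) (@rep_ter1 _ _ _ _ _ r)
    (@rep_ter0 _ _ _ _ _ r) (rep_sq1 r) (rep_sq0 r) (rep_trace1 r) (rep_trace0 r).

(** * Recovering the conditions on [k1] from those on [k0] and one trace adjointness *)

Section HalfRep.
Variables (D : monoidal_dagger_category) (bp : dagger_biproducts D).
Hypothesis distr : distributive bp.
Variables (M : linking D) (B : D) (N : frob2 B).
Hypothesis B_rdistr : rdistr bp B.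
Notation mu := (μ N).
Notation tr := ((u N)^† \o mu).
Notation cup := (mu^† \o u N).
Variables (k0 : hom (X0 M) B) (k1 : hom (X1 M) B).
Hypothesis ter0 : forall P Q R S (a : el (X0 M) P Q) (b : el (X1 M) Q R)
    (c : el (X0 M) R S),
  k0 • t0 M • a ⊡ b ⊡ c = mu • (mu • (k0 • a) ⊡ (k1 • b)) ⊡ (k0 • c).
Hypothesis sq0 : mu \o (k0 ⊗ k0) = zerom bp _ _.
Hypothesis trace0 : tr \o (k0 ⊗ idm B) = e0 M \o (idm (X0 M) ⊗ k1^†).

Lemma half_cup0 P : (k0^† • cupl cup P) ⊡ cupr B P
  = cupl (e0 M)^† P ⊡ (k1 • cupr (X1 M) P).
Proof.
have := f_equal dag trace0; rewrite !dagM !dag_tensm !dag1 !dagK.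
move=> /(f_equal (fun f => f • one P)); rewrite !(act_comp (_ ⊗ _)).
by rewrite !act_cup !act_tens !act_id.
Qed.

(** The dagger of [trace0] expresses [k0^†] as a trace against [k1]; a snake identity then exchanges
    the roles of the two maps. *)
Lemma half_trace1 : tr \o (k1 ⊗ idm B) = e1 M \o (idm (X1 M) ⊗ k0^†).
Proof.
apply: act_inj2 => P Q R b y; rewrite !(act_comp tr) !(act_comp (e1 M)).
have E : k0^† • y = scr (cupl (e0 M)^† Q) (tr • (k1 • cupr (X1 M) Q) ⊡ y).
  rewrite -[in LHS](trace_snake' N y) act_scr.
  have := f_equal (fun x => ρ (X0 M) • (idm _ ⊗ tr) • α _ _ _ • x ⊡ y) (half_cup0 Q).
  move: tr cup => t c.
  by rewrite !act_α !act_tens !act_id.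
rewrite !act_tens !act_id E; move: tr => t.
rewrite -scr_tens act_scr scr_scalar -act_scl -scl_tens -act_scl.
by rewrite (@zig_el _ (flip M)).
Qed.

Lemma half_cup1 P : (k1^† • cupl cup P) ⊡ cupr B P
  = cupl (e1 M)^† P ⊡ (k0 • cupr (X0 M) P).
Proof.
have := f_equal dag half_trace1; rewrite !dagM !dag_tensm !dag1 !dagK.
move=> /(f_equal (fun f => f • one P)); rewrite !(act_comp (_ ⊗ _)).
by rewrite !act_cup !act_tens !act_id.
Qed.

(** Under the trace, one factor [k1] turns into [k0^†] applied to a product that starts with the
    other. The map [E] so obtained factors through the dagger of [sq0], hence vanishes. *)
Lemma half_sq1 : mu \o (k1 ⊗ k1) = zerom bp _ _.
Proof.
have dag_sq0 : (k0^† ⊗ k0^†) \o mu^† = zerom bp _ _.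
  by rewrite -dag_tensm -dagM sq0 dag_zero.
have E : k0^† \o mu \o (k1 ⊗ idm B) = zerom bp _ _.
  have -> : k0^† \o mu \o (k1 ⊗ idm B)
      = λ _ \o (e1 M ⊗ idm _) \o (α _ _ _)^† \o (idm _ ⊗ ((k0^† ⊗ k0^†) \o mu^†)).
    apply: act_inj2 => P Q R b y.
    have [S [y1 [y2 yE]]] := tensel_surj (mu^† • y).
    rewrite !act_comp !act_tens !act_id act_comp yE act_tens act_αV act_tens act_id.
    have := f_equal (fun f => f • b ⊡ y1) half_trace1.
    rewrite (act_comp (e1 M)) !(act_tens, act_id) (act_comp tr) !(act_tens, act_id) => <-.
    by rewrite (mul_trace _ yE) act_scl.
  by rewrite dag_sq0 tensm0 // compm0.
apply: (trace_inj (N := N)); rewrite tens0m // compm0.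
have -> : tr \o ((mu \o (k1 ⊗ k1)) ⊗ idm B)
    = tr \o (k1 ⊗ idm B) \o (idm _ ⊗ (mu \o (k1 ⊗ idm B))) \o α _ _ _.
  apply: act_inj3 => P Q R S a b c.
  have T := @trace_mul _ _ N; move: tr T => t T.
  by rewrite !(act_comp, act_tens, act_α, act_id) T.
rewrite half_trace1 -(compA (e1 M)) -tensmM comp1f compA E.
by rewrite tensm0 // compm0 comp0m.
Qed.

(** This is the adjoint form of [ter0]: after daggers, the cups of [half_cup0] and [half_cup1] turn
    comultiplications into products of values of [k0] and [k1]. *)
Lemma half_ter_dag P Q R S (c : el (X0 M) P Q) (d : el (X1 M) Q R) (y : el B R S) :
  k0^† • mu • (k0 • c) ⊡ (mu • (k1 • d) ⊡ y) = t0 M • c ⊡ d ⊡ (k0^† • y).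
Proof.
have E : k0^† \o mu \o (k0 ⊗ (mu \o (k1 ⊗ idm B)))
    = t0 M \o (α _ _ _)^† \o (idm _ ⊗ (idm _ ⊗ k0^†)).
  rewrite -[LHS]dagK -[RHS]dagK; congr (_^†).
  rewrite !dagM !dag_tensm !dagM !dag_tensm !dag1 !dagK.
  apply: act_inj => P' Q' x; rewrite !act_comp t_dag_cyclic !act_tens !act_id.
  rewrite comul_cup act_tens -(act_comp _ mu) (tens_act_congr _ _ (half_cup0 P')).
  congr (_ ⊡ _); rewrite !act_comp comul_cup act_tens act_id.
  by rewrite (tens_act_congr _ _ (half_cup1 _)) ter0 mul_assoc.
have := f_equal (fun f => f • c ⊡ (d ⊡ y)) E.
by rewrite !(act_comp, act_tens, act_id, act_αV).
Qed.

(** Both sides are tested against the trace form: [half_trace1] moves [k1] across as [k0^†], where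
    [half_ter_dag] and cyclicity apply. *)
Lemma half_ter1 P Q R S (a : el (X1 M) P Q) (b : el (X0 M) Q R) (c : el (X1 M) R S) :
  k1 • t1 M • a ⊡ b ⊡ c = mu • (mu • (k1 • a) ⊡ (k0 • b)) ⊡ (k1 • c).
Proof.
have E : k1 \o t1 M = mu \o ((mu \o (k1 ⊗ k0)) ⊗ k1).
  apply: (trace_inj (N := N)); apply: act_inj2 => P' Q' R' x y.
  have T P1 Q1 R1 (w : el (X1 M) P1 Q1) (z : el B Q1 R1) :
      tr • (k1 • w) ⊡ z = e1 M • w ⊡ (k0^† • z).
    have := f_equal (fun f => f • w ⊡ z) half_trace1; move: tr => t.
    by rewrite !(act_comp, act_tens, act_id).
  have [S1 [x12 [x3 ->]]] := tensel_surj x; have [S2 [x1 [x2 ->]]] := tensel_surj x12.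
  have A := trace_mul N; move: tr T A => t T A.
  rewrite !(act_comp, act_tens, act_id) !A !T.
  by rewrite half_ter_dag -(@e_cyclic _ (flip M)).
have := f_equal (fun f => f • a ⊡ b ⊡ c) E.
by rewrite !(act_comp, act_tens, act_id).
Qed.

Definition half_rep : linking_rep bp M N :=
  @LinkingRep D bp M B N k0 k1 ter0 (@half_ter1) sq0 half_sq1 trace0 half_trace1.

End HalfRep.

(** * Extending a representation from the generators to all blocks *)

Section RepBlocks.
Variables (D : monoidal_dagger_category) (bp : dagger_biproducts D).
Hypothesis distr : distributive bp.
Variables (B : D) (N : frob2 B).
Hypothesis B_rdistr : rdistr bp B.
Notation mu := (μ N).
Notation tr := ((u N)^† \o mu).

Definition repL (M : linking D) (r : linking_rep bp M N) : hom (L0 M) B :=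
  mu \o (k0 r ⊗ k1 r) \o s0 M.

(** Any representative may be used: the cup inserted by the projection moves into the [k1] factor
    and disappears by [tr1]. *)
Lemma repLE (M : linking D) (r : linking_rep bp M N) P Q R
    (a : el (X0 M) P Q) (b : el (X1 M) Q R) :
  repL r • (s0 M)^† • a ⊡ b = mu • (k0 r • a) ⊡ (k1 r • b).
Proof.
rewrite !act_comp s_s_dag tprojE act_tens rep_ter0 !mul_assoc -(mul_assoc N (k1 r • b)).
by rewrite -rep_ter1 tr1.
Qed.

Lemma rep_traceE (M : linking D) (r : linking_rep bp M N) P Q R
    (a : el (X0 M) P Q) (y : el B Q R) :
  tr • (k0 r • a) ⊡ y = e0 M • a ⊡ ((k1 r)^† • y).
Proof.
have := f_equal (fun f => f • a ⊡ y) (rep_trace0 r); move: tr => t.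
by rewrite !(act_comp, act_tens, act_id).
Qed.

(** Both sides become [e0] of [a] with [k1^†] of the product of [k1 • b] and [y]: on the left by
    adjointness, on the right by comultiplying [y] and contracting [b] with the first leg. *)
Lemma repL_trace (M : linking D) (r : linking_rep bp M N) :
  tr \o (repL r ⊗ idm B) = (unitL M)^† \o mulLL M \o (idm _ ⊗ (repL r)^†).
Proof.
apply: act_inj2 => P Q R x y; have [S [a [b [xE sx]]]] := left_op_surj x.
have [T [y1 [y2 yE]]] := tensel_surj (mu^† • y).
have rep_dag : (repL r)^† = (s0 M)^† \o ((k0 r)^† ⊗ (k1 r)^†) \o mu^†.
  by rewrite !dagM dag_tensm !compA.
have e_s : (unitL M)^† \o (s0 M)^† = e0 M.
  by rewrite /unitL dagM !dagK -compA -split0 e_tproj.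
have pE : tproj (e0 M) (t0 M) • a ⊡ b = a ⊡ b by rewrite -sx -act_comp tproj_s.
rewrite (act_comp tr) act_tens act_id {1}/repL !(act_comp _ (s0 M)) sx.
rewrite (act_comp mu) act_tens trace_mul (rep_traceE r).
rewrite (act_comp ((unitL M)^† \o mulLL M)) act_tens act_id rep_dag.
rewrite (act_comp _ mu^†) yE (act_comp (s0 M)^†) act_tens xE (act_comp _ (mulLL M)) mulLLE.
rewrite -(act_comp (unitL M)^†) e_s.
rewrite t_pair pE act_α act_tens act_id -/(scr _ _) -tens_scl -(rep_traceE (flip_rep r)).
by rewrite -act_scl (mul_trace _ yE).
Qed.

Definition rblk (M : linking D) (r : linking_rep bp M N) (i j : bool) : hom (lblk M i j) B :=
  match i, j with
  | false, false => repL r | false, true => k0 r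
  | true, false => k1 r | true, true => repL (flip_rep r)
  end.

Lemma rblk_mul (M : linking D) (r : linking_rep bp M N) i j k :
  rblk r i k \o lmul M i j k = mu \o (rblk r i j ⊗ rblk r j k).
Proof.
suff E M' (r' : linking_rep bp M' N) j' k' :
    rblk r' false k' \o lmul M' false j' k' = mu \o (rblk r' false j' ⊗ rblk r' j' k').
  by case: i; [move: (E _ (flip_rep r) (negb j) (negb k)); case: j; case: k|exact: E].
case: j'; case: k' => /=; apply: act_inj2 => P Q R x y; rewrite (act_comp mu) act_tens.
- have /= [S [a [b [-> _]]]] := @left_op_surj _ (flip M') _ _ y.
  by rewrite (act_comp _ (mulXL _)) mulXLE rep_ter0 (repLE (flip_rep r')) mul_assoc.
- by rewrite (act_comp (repL _)) /mulXX repLE.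
- have [S [a [b [-> _]]]] := left_op_surj x.
  by rewrite (act_comp _ (mulLX _)) mulLXE rep_ter0 repLE.
- have [S [a [b [-> _]]]] := left_op_surj x.
  have [S' [c [d [-> _]]]] := left_op_surj y.
  by rewrite (act_comp _ (mulLL _)) mulLLE !repLE rep_ter0 !mul_assoc.
Qed.

(** A mismatch of indices puts two values of [k0] or two values of [k1] next to each other; [Z] and
    [Z'] expose them inside the [L0] and [L1] blocks. *)
Lemma rblk_mul0 (M : linking D) (r : linking_rep bp M N) i j l :
  mu \o (rblk r i j ⊗ rblk r (negb j) l) = zerom bp _ _.
Proof.
suff E M' (r' : linking_rep bp M' N) j' l' :
    mu \o (rblk r' false j' ⊗ rblk r' (negb j') l') = zerom bp _ _.
  by case: i; [move: (E _ (flip_rep r) (negb j) (negb l)); case: j; case: l|exact: E].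
have Z (M1 : linking D) (r1 : linking_rep bp M1 N) : mu \o (k0 r1 ⊗ repL r1) = zerom bp _ _.
  have -> : mu \o (k0 r1 ⊗ repL r1)
      = mu \o ((mu \o (k0 r1 ⊗ k0 r1)) ⊗ k1 r1) \o (α _ _ _)^† \o (idm _ ⊗ s0 M1).
    apply: act_inj2 => P Q R x y; have [S [a [b E]]] := tensel_surj (s0 M1 • y).
    by rewrite !(act_comp, act_tens, act_id) E !(act_comp, act_tens, act_αV) mul_assoc.
  by rewrite rep_sq0 tens0m // compm0 !comp0m.
have Z' (M1 : linking D) (r1 : linking_rep bp M1 N) (A : D) (f : hom A B) :
    mu \o (k1 r1 ⊗ f) = zerom bp _ _ -> mu \o (repL r1 ⊗ f) = zerom bp _ _.
  move=> E.
  have -> : mu \o (repL r1 ⊗ f)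
      = mu \o (k0 r1 ⊗ (mu \o (k1 r1 ⊗ f))) \o α _ _ _ \o (s0 M1 ⊗ idm _).
    apply: act_inj2 => P Q R x y; have [S [a [b Ex]]] := tensel_surj (s0 M1 • x).
    by rewrite !(act_comp, act_tens, act_id) Ex !(act_comp, act_tens, act_α, act_id) mul_assoc.
  by rewrite E tensm0 // compm0 !comp0m.
case: j'; case: l' => /=.
- exact: rep_sq0.
- exact: Z.
- apply: Z'; exact: (Z _ (flip_rep r')).
- apply: Z'; exact: rep_sq1.
Qed.

Lemma rblk_trace (M : linking D) (r : linking_rep bp M N) i j :
  tr \o (rblk r i j ⊗ idm B)
  = (lunit M i)^† \o lmul M i j i \o (idm _ ⊗ (rblk r j i)^†).
Proof.
suff E M' (r' : linking_rep bp M' N) j' : tr \o (rblk r' false j' ⊗ idm B)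
    = (lunit M' false)^† \o lmul M' false j' false \o (idm _ ⊗ (rblk r' j' false)^†).
  by case: i; [move: (E _ (flip_rep r) (negb j)); case: j|exact: E].
case: j' => /=; last exact: repL_trace.
by rewrite rep_trace0 /unitL dagM !dagK -(compA (e0 M')) -split0 e_tproj.
Qed.

End RepBlocks.

(** * The adjunction *)

Section SelfDual.
Variable D : monoidal_dagger_category.

Lemma self_dual_invol_l (B : D) (N : frob2 B) :
  involution_l (B := self_dual N) N = idm B.
Proof. by rewrite /involution_l /η' /= dagM dagK frob2_snake1. Qed.

Lemma self_dual_invol_r (B : D) (N : frob2 B) :
  involution_r (B := self_dual N) N = idm B.
Proof. by rewrite /involution_r /= frob2_snake2. Qed.

(* A dagger Frobenius monoid is symmetric with trivial involution for the dual
   given by its own Frobenius form. *)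
Definition self_sym (B : D) (N : frob2 B) : sym_frob2 D :=
  @SymFrob2 D (self_dual N) N
    (eq_trans (self_dual_invol_l N) (eq_sym (self_dual_invol_r N))).

Lemma self_sym_invol (B : D) (N : frob2 B) : invol (self_sym N) = idm B.
Proof. exact: self_dual_invol_l. Qed.

Lemma trace_invol_dag (B : sym_frob2 D) :
  (u (s2_frob B))^† \o μ (s2_frob B) \o (idm B ⊗ (invol B)^†) = ε B.
Proof. by rewrite invol_dag_curry; apply: (@ε_curry D (self_dual (s2_frob B))). Qed.

End SelfDual.

Section MatrixTrace.
Variables (D : monoidal_dagger_category) (bp : dagger_biproducts D).
Hypothesis distr : distributive bp.
Variable F : frobenius_blocks D.
Hypothesis F_rdistr : forall i j, rdistr bp (blk F i j).
Notation inj := (inj bp (blk F)).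

Lemma munit_inj i : (munit bp F)^† \o inj i i = (bunit F i)^†.
Proof.
rewrite /munit dag_sum2 sum2_comp (sum2_pick i) dagM -compA.
  by rewrite inj_row compm0.
by rewrite inj_id compf1.
Qed.

Lemma munit_inj0 i : (munit bp F)^† \o inj i (negb i) = zerom bp _ _.
Proof.
rewrite /munit dag_sum2 sum2_comp (sum2_pick i) dagM -compA.
  by rewrite inj_row compm0.
by rewrite inj_col' compm0.
Qed.

(** The trace form of the matrices couples a block only with its transposed block. *)
Lemma mtrace_inj i j :
  (munit bp F)^† \o mmul bp F \o (inj i j ⊗ idm _)
  = (bunit F i)^† \o bmul F i j i \o (idm _ ⊗ (inj j i)^†).
Proof.
apply: mx_ext_tensr => // k l; rewrite -!(compA _ _ (idm _ ⊗ _)) -!tensmM !comp1f !compf1.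
have [->|->] := eq_or_negb j k; last first.
  by rewrite inj_row' -(compA _ (mmul _ _)) mmul_inj0 // tensm0 // !compm0.
rewrite -(compA _ (mmul _ _)) mmul_inj // compA.
have [->|->] := eq_or_negb i l; first by rewrite munit_inj inj_id tensm1 compf1.
by rewrite munit_inj0 inj_col' tensm0 // compm0 comp0m.
Qed.

End MatrixTrace.

(** * The envelope of a normal 3-structure and its universal property *)

Section Envelope.
Variables (D : monoidal_dagger_category) (bp : dagger_biproducts D).
Hypothesis distr : distributive bp.
Hypothesis split : dagger_idempotents_split D.

(** Splittings are assumed to exist only as a proposition, so choice supplies the data from which
    objects are built. *)
Definition splitting (A : D) (p : hom A A) (pid : dagger_idempotent p) :
    {L : D & {s : hom L A | isometry s /\ p = s \o s^†}} :=
  let L := constructive_indefinite_description _ (split pid) in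
  existT _ (proj1_sig L) (constructive_indefinite_description _ (proj2_sig L)).

Definition linking3 (A : normal_frob3 D) : linking D :=
  let S := splitting (tproj_nter_idem A) in
  let S' := splitting (tproj_conter_idem A) in
  linking_of_frob3
    (proj1 (proj2_sig (projT2 S))) (proj2 (proj2_sig (projT2 S)))
    (proj1 (proj2_sig (projT2 S'))) (proj2 (proj2_sig (projT2 S'))).

Definition blocks3 (A : normal_frob3 D) : frobenius_blocks D := lblocks (linking3 A).

Lemma blocks3_rdistr (A : normal_frob3 D) i j : rdistr bp (blk (blocks3 A) i j).
Proof.
have rA := rdistr_dobj bp A; have rA' := rdistr_dual bp A.
case: i; case: j => //=.
  exact: rdistr_retract (iso1 (linking3 A)) (rdistr_tens rA' rA).
exact: rdistr_retract (iso0 (linking3 A)) (rdistr_tens rA rA').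
Qed.

Definition env_obj (A : normal_frob3 D) : D := mx bp (blk (blocks3 A)).

Definition env (A : normal_frob3 D) : sym_frob2 D :=
  self_sym (mx_frob2 distr (@blocks3_rdistr A)).

Definition env_incl (A : normal_frob3 D) : hom A (env A) :=
  inj bp (blk (blocks3 A)) false true.

Definition env_coincl (A : normal_frob3 D) : hom (dual A) (env A) :=
  inj bp (blk (blocks3 A)) true false.

(** The envelope is its own dual with the trace form as [ε], so the conjugate is read off from the
    trace on the block [false true]. *)
Lemma env_incl_star (A : normal_frob3 D) : lower_star (env_incl A) = env_coincl A.
Proof.
rewrite -[RHS]dagK; congr (_^†); apply: ε_inj; rewrite ε_upper_star.
rewrite [LHS](@mtrace_inj _ _ distr (blocks3 A) (@blocks3_rdistr A) false true).
congr (_ \o _); rewrite [bunit _ _]/= /unitL dagM !dagK [bmul _ _ _ _]/= /mulXX.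
by rewrite -compA -split0 e_tproj.
Qed.

Lemma env_incl_mor (A : normal_frob3 D) :
  is_morphism3 (nter A) (ternary_of (env A)) (env_incl A).
Proof.
rewrite /is_morphism3 env_incl_star /ternary_of self_sym_invol dag1 !tensm1 compf1.
rewrite -(compA (mult _)) -tensmM comp1f.
have -> : mult (env A) \o (env_incl A ⊗ env_coincl A)
    = inj bp (blk (blocks3 A)) false false \o (s0 (linking3 A))^†.
  exact: (mmul_inj distr (@blocks3_rdistr A) false true false).
rewrite [RHS](@mmul_injl _ _ distr _ (@blocks3_rdistr A) false false true _ (s0 (linking3 A))^†).
rewrite -compA; congr (_ \o _); apply: act_inj2 => P Q R z a.
rewrite [bmul _ _ _ _]/= /mulLX !(act_comp, act_tens, act_id) s_s_dag.
by rewrite t_tproj.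
Qed.

Lemma env_incl_iso (A : normal_frob3 D) : isometry (env_incl A).
Proof. exact: (inj_id bp (blk (blocks3 A)) false true). Qed.

Lemma env_incl_sq0 (A : normal_frob3 D) :
  mult (env A) \o (env_incl A ⊗ env_incl A) = zerom bp (A ⊗ A) (env A).
Proof. exact: (mmul_inj0 distr (@blocks3_rdistr A) false true true). Qed.

Definition env_sub (A : normal_frob3 D) : sub_frob2 bp :=
  @SubFrob2 D bp A (env A) (env_incl A)
    (conj (env_incl_iso A) (env_incl_mor A)) (env_incl_sq0 A).

Lemma env_special (A : normal_frob3 D) :
  (forall (X Y : D) (f : hom X Y), addm bp f f = f) ->
  special (s2_frob (sub2 (env_sub A))).
Proof. exact: mx_special. Qed.

Section Extension.
Variables (A : normal_frob3 D) (Y : sub_frob2 bp) (g : hom A (sub3 Y)).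
Hypothesis g_mor : is_morphism3 (nter A) (nter (sub3 Y)) g.
Notation N := (s2_frob (sub2 Y)).
Notation h := (incl Y \o g).
Notation k := ((invol (sub2 Y))^† \o lower_star h).

Lemma ext_ter P Q R S (a : el A P Q) (b : el (dual A) Q R) (c : el A R S) :
  h • nter A • a ⊡ b ⊡ c = μ N • (μ N • (h • a) ⊡ (k • b)) ⊡ (h • c).
Proof.
have [_ i_mor] := incl_sub3 Y.
have := f_equal (fun f => f • a ⊡ b ⊡ c) (morphism3_comp i_mor g_mor).
rewrite /ternary_of /mult; move: h (lower_star h) => h' hs.
by rewrite !(act_comp, act_tens, act_id).
Qed.

Lemma ext_sq0 : μ N \o (h ⊗ h) = zerom bp _ _.
Proof. by rewrite tensmM (compA (μ N)) (incl_sq0 Y) comp0m. Qed.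

(** The involution converts the trace form into [ε], after which this is the defining property of
    [upper_star]. *)
Lemma ext_trace : (u N)^† \o μ N \o (h ⊗ idm _) = ε A \o (idm A ⊗ k^†).
Proof.
have [jVj _] := invol_unitary (sub2 Y).
rewrite dagM !dagK tens_compr compA ε_upper_star -trace_invol_dag.
rewrite -(compA _ (idm _ ⊗ _)) -(compA _ _ (idm A ⊗ _)) -!tensmM !comp1f compf1.
by rewrite compf1 jVj.
Qed.

Definition ext_rep : linking_rep bp (linking3 A) N :=
  half_rep (M := linking3 A) distr (rdistr_dobj bp (sub2 Y)) ext_ter ext_sq0 ext_trace.

Definition ext : hom (env_obj A) (sub2 Y) :=
  sum2 bp (fun i => sum2 bp (fun j => rblk ext_rep i j \o (inj bp (blk (blocks3 A)) i j)^†)).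

Notation inj := (inj bp (blk (blocks3 A))).

Lemma ext_inj i j : ext \o inj i j = rblk ext_rep i j.
Proof.
rewrite /ext sum2_comp (sum2_pick i).
  by rewrite /sum2 !addm_comp -!compA !inj_row !compm0 addm0.
rewrite sum2_comp (sum2_pick j) -compA; last by rewrite inj_id compf1.
by rewrite inj_col compm0.
Qed.

Lemma ext_mul : ext \o mmul bp (blocks3 A) = μ N \o (ext ⊗ ext).
Proof.
have rA := @blocks3_rdistr A; have rY := rdistr_dobj bp (sub2 Y).
apply: mx_ext2 => // i j k l; rewrite -[LHS]compA -[RHS]compA -tensmM !ext_inj.
have [->|->] := eq_or_negb j k.
  by rewrite mmul_inj // compA ext_inj rblk_mul.
by rewrite mmul_inj0 // compm0 rblk_mul0.
Qed.

Lemma ext_trace_adj :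
  (u N)^† \o μ N \o (ext ⊗ idm (sub2 Y))
  = (munit bp (blocks3 A))^† \o mmul bp (blocks3 A) \o (idm (env_obj A) ⊗ ext^†).
Proof.
have rA := @blocks3_rdistr A; have rY := rdistr_dobj bp (sub2 Y).
apply: mx_ext_tensl => // i j.
rewrite -[LHS]compA -tensmM ext_inj compf1 rblk_trace //.
rewrite -[RHS]compA tens_swap [RHS]compA mtrace_inj //.
rewrite -[RHS]compA -tens_compr -dagM ext_inj.
by [].
Qed.

(** With trivial involution on the envelope, compatibility with involutions is [ext_trace_adj]
    transposed along [ε]. *)
Lemma ext_mor2 : is_morphism2 (B := env A) ext.
Proof.
split; first exact: ext_mul.
rewrite self_sym_invol compf1 /lower_star -[LHS]dagK; congr (_^†).
apply: (@ε_inj D (env A)); rewrite ε_upper_star dagM tens_compr compA.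
rewrite -[ε (env A) \o _]ext_trace_adj -trace_invol_dag -[LHS]compA -[RHS]compA.
by rewrite tens_swap.
Qed.

Lemma ext_incl : ext \o env_incl A = h.
Proof. exact: (ext_inj false true). Qed.

Lemma ext_restrict : (incl Y)^† \o ext \o env_incl A = g.
Proof.
by rewrite -compA ext_incl compA; have [-> _] := incl_sub3 Y; rewrite comp1f.
Qed.

Lemma ext_mor : is_morphism_sub (X := env_sub A) (Y := Y) ext.
Proof.
split; first exact: ext_mor2.
by rewrite -!(compA (incl Y)) [X in incl Y \o X]ext_restrict; exact: ext_incl.
Qed.

End Extension.

Lemma env_hom_inj (A : normal_frob3 D) (Y : sub_frob2 bp) (f f' : hom (env A) (sub2 Y)) :
  is_morphism2 f -> is_morphism2 f' -> f \o env_incl A = f' \o env_incl A -> f = f'.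
Proof.
move=> fm fm' E.
(* Compatibility with the involutions forces the values on the dual generator. *)
have co (F : hom (env A) (sub2 Y)) : is_morphism2 F ->
    F \o env_coincl A = (invol (sub2 Y))^† \o lower_star (F \o env_incl A).
  move=> [_ Fj]; have [jVj _] := invol_unitary (sub2 Y).
  rewrite lower_starM env_incl_star [RHS]compA; congr (_ \o _).
  by rewrite -[LHS]comp1f -jVj -compA Fj self_sym_invol compf1.
have Eco : f \o env_coincl A = f' \o env_coincl A by rewrite !co // E.
have gen i j k (F : hom (env A) (sub2 Y)) : is_morphism2 F ->
    F \o inj bp (blk (blocks3 A)) i k \o bmul (blocks3 A) i j k
    = mult (sub2 Y) \o ((F \o inj bp (blk (blocks3 A)) i j)
                         ⊗ (F \o inj bp (blk (blocks3 A)) j k)).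
  have rA := @blocks3_rdistr A; move=> [Fμ _].
  rewrite -[LHS]compA -mmul_inj // [LHS]compA.
  have -> : F \o mmul bp (blocks3 A) = mult (sub2 Y) \o (F ⊗ F) := Fμ.
  by rewrite -[LHS]compA -tensmM.
apply: mx_ext => i j; case: i; case: j; [|exact: Eco|exact: E|].
  (* On the diagonal blocks, [s1^†] and [s0^†] are split epimorphisms and equal to block products of
     the generators. *)
  by apply: (epi_of_rinv (iso1 (linking3 A))); rewrite !(gen true false true) // E Eco.
by apply: (epi_of_rinv (iso0 (linking3 A))); rewrite !(gen false true false) // E Eco.
Qed.

Notation C3 := (frob3n_category D).
Notation Csub := (sub_category bp).
Notation S := (restriction bp).

Definition extend (A : C3) (Y : Csub) (g : hom A (S Y)) : @hom Csub (env_sub A) Y :=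
  exist _ (ext (proj2_sig g)) (ext_mor (proj2_sig g)).

Lemma fmap_extend (A : C3) (Y : Csub) (g : hom A (S Y)) :
  fmap S (extend g) = g :> hom A (S Y).
Proof. by apply: sig_eq; apply: ext_restrict. Qed.

(** With [fmap_extend] this is the universal property: functoriality, naturality and the first
    triangle are checked after restriction. *)
Lemma fmap_restriction_inj (A : C3) (Y : Csub) (f f' : @hom Csub (env_sub A) Y) :
  fmap S f = fmap S f' -> f = f'.
Proof.
move=> /(f_equal (@proj1_sig _ _)) /= E; apply: sig_eq.
have [fm fi] := proj2_sig f; have [f'm f'i] := proj2_sig f'.
apply: env_hom_inj => //; rewrite [LHS]fi [RHS]f'i.
by rewrite -!(compA (incl Y)) E.
Qed.

Definition envelope : functor C3 Csub.
Proof.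
refine (@Functor C3 Csub env_sub
  (fun A B g => @extend A (env_sub B) g) _ _).
- move=> A; apply: fmap_restriction_inj; rewrite fmap_extend.
  by rewrite (fmap1 S).
- move=> A B X g f; apply: fmap_restriction_inj; rewrite fmapM.
  by rewrite !fmap_extend.
Defined.

(** Restricting the envelope of [A] returns [A] by computation, so identities serve as the unit; the
    counit extends an identity. *)
Definition envelope_adjunction : adjunction envelope S.
Proof.
refine (@Adjunction C3 Csub envelope S (fun A => idm A)
  (fun Y => extend (idm (S Y))) _ _ _ _).
- move=> A B f; rewrite comp1f compf1; symmetry; exact: fmap_extend.
- move=> Y Y' g; apply: fmap_restriction_inj.
  rewrite !fmapM !fmap_extend.
  by rewrite comp1f compf1.
- move=> A; apply: fmap_restriction_inj.
  by rewrite fmapM !fmap_extend fmap1 comp1f.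
- by move=> Y; rewrite compf1 fmap_extend.
Defined.

End Envelope.

Theorem theorem7p11 (D : monoidal_dagger_category) (bp : dagger_biproducts D)
    (hdistr : distributive bp) (hsplit : dagger_idempotents_split D) :
  exists (E : functor (frob3n_category D) (sub_category bp))
         (adj : adjunction E (restriction bp)),
    (forall m : frob3n_category D, is_identity (adj_unit adj m))
    /\ ((forall (A B : D) (f : hom A B), addm bp f f = f) ->
        forall m : frob3n_category D, special (s2_frob (sub2 (E m)))).
Proof.
exists (envelope hdistr hsplit), (envelope_adjunction hdistr hsplit); split.
  by move=> m; apply: IsIdentity.
by move=> idem m; apply: env_special.
Qed.
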